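(* Let $k\ge1$, $n\ge2k+2$ and let $\mathbb{K}$ be a field. The Pfaffians of degree $k+1$ (one for each $U\subset[n]$ with $|U|=2k+2$) are a Gröbner basis for $I_k(n)$ with respect to any fp-positive vector $v\in\mathrm{FP}_n$. If the fp-positive vector $v$ is sufficiently generic, then $\mathrm{in}_v(I_k(n))$ is the monomial ideal generated by all $(k+1)$-crossings, i.e. by the monomials $\prod_{\{i,j\}\in C}x_{i,j}$ for all $(k+1)$-crossings $C\subset\binom{[n]}{2}$.
   Context: Edges $\{i,j\},\{i',j'\}\in\binom{[n]}{2}$ with $i<j$, $i'<j'$ cross if $i<i'<j<j'$ or $i'<i<j'<j$. A $(k+1)$-crossing is a set of $k+1$ mutually crossing edges. The Pfaffian of degree $k+1$ of $U$ is $\sum_E(-1)^{\mathrm{cr}(E)}\prod_{\{i,j\}\in E}x_{i,j}$ over perfect matchings $E$ of $U$, where $\mathrm{cr}(E)$ is the number of crossing pairs of edges in $E$. $I_k(n)\subset\mathbb{K}[x_{i,j}:\{i,j\}\in\binom{[n]}{2}]$ is the ideal generated by these Pfaffians. $\mathrm{FP}_n$ is the set of (fp-positive) vectors $v\in\mathbb{R}^{\binom{[n]}{2}}$ with $v_{a,b}+v_{a',b'}\ge\max\{v_{a,a'}+v_{b,b'},\,v_{a,b'}+v_{a',b}\}$ for all $1\le a<a'<b<b'\le n$. For a weight vector $v$, $\mathrm{in}_v(f)$ is the sum of terms of $f$ of maximum $v$-weight, $\mathrm{in}_v(I)$ is the ideal generated by $\mathrm{in}_v(f)$ for $f\in I$,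 and $B\subset I$ is a Gröbner basis of $I$ with respect to $v$ if $\{\mathrm{in}_v(f):f\in B\}$ generates $\mathrm{in}_v(I)$. ''Sufficiently generic'' means outside some finite union of proper linear hyperplanes. *)

(* Defs.v *)
From HB Require Import structures.
From mathcomp Require Import all_boot all_order all_algebra.
From mathcomp Require Import classical_sets reals.
From mathcomp Require Import mpoly.

Set Implicit Arguments.
Unset Strict Implicit.
Unset Printing Implicit Defensive.

Import Order.TTheory GRing.Theory Num.Theory.
Local Open Scope ring_scope.

(* An edge {i, j} is stored as its increasing pair (i, j) with i < j; the
   vertex set [n] is 'I_n, i.e. {0, ..., n-1}. *)
Definition edge (n : nat) : Type := {e : 'I_n * 'I_n | (e.1 < e.2)%N}.
HB.instance Definition _ n := SubFinite.on (edge n).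

Section Edges.
Variable n : nat.
Implicit Types (e f : edge n) (C E : {set edge n}) (U : {set 'I_n}).

Definition mkedge (i j : 'I_n) (lt_ij : (i < j)%N) : edge n :=
  exist _ (i, j) lt_ij.

Definition ends e : {set 'I_n} := [set (val e).1; (val e).2].

Definition crosses e f : bool :=
  let: (i, j) := val e in let: (i', j') := val f in
  [&& i < i', i' < j & j < j']%N || [&& i' < i, i < j' & j' < j]%N.

Definition is_crossing (m : nat) C : bool :=
  (#|C| == m) &&
  [forall e in C, forall f in C, (e != f) ==> crosses e f].

Definition perfect_matching U E : bool := finset.partition (ends @: E) U.

(* 2-crossings contained in E = unordered pairs of crossing edges of E *)
Definition cr E : nat := #|[set D in powerset E | is_crossing 2 D]|.

End Edges.

Local Open Scope classical_set_scope.

(* K[x_{i,j}], with one variable per edge, numbered by enum_rank. *)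
Notation edge_poly K n := {mpoly K[#|{: edge n}|]}.

Section Pfaffians.
Variables (K : fieldType) (n : nat).

Definition edge_var (e : edge n) : edge_poly K n := 'X_(enum_rank e).

Definition edge_monomial (E : {set edge n}) : edge_poly K n :=
  \prod_(e in E) edge_var e.

Definition pfaffian (U : {set 'I_n}) : edge_poly K n :=
  \sum_(E : {set edge n} | perfect_matching U E)
     (-1) ^+ cr E * edge_monomial E.

Definition pfaffians (d : nat) : set (edge_poly K n) :=
  [set f | exists U : {set 'I_n}, #|U| = (2 * d)%N /\ f = pfaffian U].

Definition crossing_monomials (m : nat) : set (edge_poly K n) :=
  [set f | exists C : {set edge n}, is_crossing m C /\ f = edge_monomial C].

End Pfaffians.

Arguments pfaffians : clear implicits.
Arguments crossing_monomials : clear implicits.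

Definition ideal_gen (A : comNzRingType) (S : set A) : set A :=
  [set f | exists (m : nat) (a g : 'I_m -> A),
     (forall i, S (g i)) /\ f = \sum_(i < m) a i * g i].

Definition pfaffian_ideal (K : fieldType) (k n : nat) : set (edge_poly K n) :=
  ideal_gen (pfaffians K n k.+1).
Arguments pfaffian_ideal : clear implicits.

Notation weight R n := {ffun edge n -> R}.

Section Weights.
Variables (R : realType) (n : nat).

Definition fp_positive (v : weight R n) : Prop :=
  forall (a a' b b' : 'I_n)
         (aa' : (a < a')%N) (a'b : (a' < b)%N) (bb' : (b < b')%N),
    let ab := ltn_trans aa' a'b in
    let a'b' := ltn_trans a'b bb' in
    let ab' := ltn_trans ab bb' in
    Num.max (v (mkedge aa') + v (mkedge bb')) (v (mkedge ab') + v (mkedge a'b))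
      <= v (mkedge ab) + v (mkedge a'b').

(* P holds for all weight vectors outside of a finite union of linear
   hyperplanes {v | <h, v> = 0}, each given by a nonzero coefficient
   vector h. *)
Definition generically (P : weight R n -> Prop) : Prop :=
  exists2 H : seq (weight R n), 0 \notin H &
    forall v : weight R n,
      (forall h : weight R n, h \in H -> \sum_(e : edge n) h e * v e != 0) ->
      P v.

Variable K : fieldType.

Definition monomial_weight (v : weight R n) (m : 'X_{1.. #|{: edge n}|}) : R :=
  \sum_(e : edge n) v e *+ m (enum_rank e).

Definition initial_form (v : weight R n) (f : edge_poly K n) : edge_poly K n :=
  \sum_(m <- msupp f |
        all (fun m' => monomial_weight v m' <= monomial_weight v m) (msupp f))
     f@_m *: 'X_[m].

Definition initial_ideal (v : weight R n) (I : set (edge_poly K n)) :=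
  ideal_gen (initial_form v @` I).

Definition groebner_basis (v : weight R n) (B I : set (edge_poly K n)) : Prop :=
  B `<=` I /\ ideal_gen (initial_form v @` B) = initial_ideal v I.

End Weights.

(* Main.v *)
Require Import Defs.
From HB Require Import structures.
From mathcomp Require Import classical_sets reals.
From mathcomp Require Import all_boot all_order all_algebra all_fingroup.
From mathcomp Require Import mpoly zify ring.

(** Call a monomial crossing-free if its support contains no (k+1)-crossing, and
    k-nest-colourable if its support is the union of k sets of edges without
    (strict) nestings.

    Under the substitution x_ij = sum_l (a_li b_lj - a_lj b_li), which kills the
    Pfaffians of degree k+1 because the generic skew form becomes of rank 2k,
    the nest-colourable monomials stay linearly independent: a coloured monomial
    contributes the product of the a_(colour, i) b_(colour, j), and it is the
    extreme one with these marginals.  Hence no nonzero element of the Pfaffian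
    ideal is supported on nest-colourable monomials.

    Read as fillings of a staircase, crossing-free monomials inject, degree by
    degree, into nest-colourable ones: keep the shapes of the RSK growth diagram
    on the boundary of the staircase, which have at most k parts, and rebuild a
    filling from them with the Burge variant of the local rule.

    For an fp-positive weight v, uncrossing shows that the crossing matching has
    maximal weight in each Pfaffian, and it is the unique maximum once ties are
    broken by the strictly fp-positive weight (j - i)(n - (j - i)).  So every
    monomial with a (k+1)-crossing is the leading monomial of a monomial
    multiple of a Pfaffian; by the two facts above these multiples are numerous
    enough to span the ideal, and taking parts of maximal v-weight in such
    combinations gives the initial ideal. *)

Set Implicit Arguments.
Unset Strict Implicit.
Unset Printing Implicit Defensive.

Import Order.TTheory GRing.Theory Num.Theory.

(** * Last passage times, shadows and antichains of entries *)

Section LastPassage.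

(** Last passage percolation: the largest total of [M] along a weakly increasing lattice path in
    [[0, x) x [0, y)]. The inner fixpoint makes the recursion structural in both coordinates. *)
Fixpoint lpp (M : nat -> nat -> nat) (x : nat) {struct x} : nat -> nat :=
  if x is x'.+1 then
    fix lpp_row y := if y is y'.+1
      then maxn (lpp M x' y) (lpp_row y') + M x' y' else 0
  else fun=> 0.

Arguments lpp : simpl never.

(* Viennot's shadow: [lpp (iter r shadow M) x y] is the (r+1)-st part of the
   RSK shape of the restriction of [M] to [0, x) x [0, y). *)
Definition shadow (M : nat -> nat -> nat) (x y : nat) : nat :=
  minn (lpp M x y.+1) (lpp M x.+1 y) - lpp M x y.

Implicit Type M : nat -> nat -> nat.

Lemma lpp0y M y : lpp M 0 y = 0. Proof. by []. Qed.
Lemma lppx0 M x : lpp M x 0 = 0. Proof. by case: x. Qed.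
Lemma lppSS M x y :
  lpp M x.+1 y.+1 = maxn (lpp M x y.+1) (lpp M x.+1 y) + M x y.
Proof. by []. Qed.

Lemma leq_lppl M x y : lpp M x y <= lpp M x.+1 y.
Proof. by case: y => [|y]; rewrite ?lppx0 // lppSS; lia. Qed.

Lemma leq_lppr M x y : lpp M x y <= lpp M x y.+1.
Proof. by case: x => [|x] //; rewrite lppSS; lia. Qed.

Lemma shadowE M x y :
  shadow M x y = minn (lpp M x y.+1) (lpp M x.+1 y) - lpp M x y.
Proof. by []. Qed.

(** By induction both earlier values of [lpp (shadow M)] are at most [lpp M x y], and [shadow M x y]
    is exactly the gap from there to the minimum. This gives the interlacing of shapes at adjacent
    corners. *)
Lemma lpp_interlace M x y :
  lpp (shadow M) x.+1 y.+1 <= minn (lpp M x y.+1) (lpp M x.+1 y).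
Proof.
elim: x y => [|x IHx] y; elim: y => [|y IHy]; rewrite lppSS shadowE.
- by rewrite !lppx0 !lpp0y; lia.
- by move: IHy; rewrite !lpp0y; lia.
- have := IHx 0; rewrite !lppx0; have := leq_lppr M x.+1 0; lia.
- have := IHx y.+1; have := IHy.
  have := leq_lppr M x.+1 y.+1; have := leq_lppl M x.+1 y.+1; lia.
Qed.

Lemma lpp_interlacel M x y : lpp (shadow M) x.+1 y <= lpp M x y.
Proof.
by case: y => [|y]; rewrite ?lppx0 //; have := lpp_interlace M x y; lia.
Qed.

Lemma lpp_interlacer M x y : lpp (shadow M) x y.+1 <= lpp M x y.
Proof. by case: x => [|x] //; have := lpp_interlace M x y; lia. Qed.

(** Moving left along row [x], the inequality stays strict across empty cells, so an entry must be
    met; [y0] is the first one. *)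
Lemma lpp_row_entry M x y : lpp M x y < lpp M x.+1 y ->
  exists y0, [/\ y0 < y, 0 < M x y0 &
    forall j, y0 < j <= y -> lpp M x j < lpp M x.+1 j].
Proof.
elim: y => [|y IH]; first by rewrite !lppx0.
move=> Hlt; have [M0|Mpos] := posnP (M x y); last first.
  exists y; split=> // j Hj; have -> : j = y.+1 by lia.
  exact: Hlt.
have Hy : lpp M x y < lpp M x.+1 y.
  by move: (Hlt); rewrite lppSS M0; have := leq_lppr M x y; lia.
have [y0 [lt0 M1 Hj]] := IH Hy; exists y0; split=> //; first lia.
move=> j Hj'; have [->//|ne] := eqVneq j y.+1; apply: Hj; lia.
Qed.

Lemma lpp_col_entry M x y : lpp M x y < lpp M x y.+1 ->
  exists x0, [/\ x0 < x, 0 < M x0 y &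
    forall i, x0 < i <= x -> lpp M i y < lpp M i y.+1].
Proof.
elim: x => [|x IH] //.
move=> Hlt; have [M0|Mpos] := posnP (M x y); last first.
  exists x; split=> // j Hj; have -> : j = x.+1 by lia.
  exact: Hlt.
have Hy : lpp M x y < lpp M x y.+1.
  by move: (Hlt); rewrite lppSS M0; have := leq_lppl M x y; lia.
have [y0 [lt0 M1 Hj]] := IH Hy; exists y0; split=> //; first lia.
move=> j Hj'; have [->//|ne] := eqVneq j x.+1; apply: Hj; lia.
Qed.

Definition antirel (p q : nat * nat) : bool := (p.1 < q.1) && (q.2 < p.2).

Lemma antirel_trans : transitive antirel.
Proof. by move=> q p r; rewrite /antirel; lia. Qed.

(* If neither the row of [p] nor the column of [q] has an entry in the
   rectangle, then [lpp] grows along both sides of the cell (p.1, q.2), which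
   forces the entry of this cell to be positive. *)
Lemma shadow_gap M p q : antirel p q -> 0 < shadow M p.1 p.2 ->
  0 < shadow M q.1 q.2 ->
  exists2 z, 0 < M z.1 z.2 & (p.1 <= z.1 < q.1) && (q.2 <= z.2 < p.2).
Proof.
case: p q => [x1 y1] [x2 y2]; rewrite /antirel /shadow /= => /andP[ltx lty] S1 S2.
have /lpp_row_entry[y0 [y0lt My0 Hrow]] : lpp M x1 y1 < lpp M x1.+1 y1 by lia.
have /lpp_col_entry[x0 [x0lt Mx0 Hcol]] : lpp M x2 y2 < lpp M x2 y2.+1 by lia.
have [le|lt] := leqP y2 y0; first by exists (x1, y0) => //=; lia.
have [le'|lt'] := leqP x1 x0; first by exists (x0, y2) => //=; lia.
exists (x1, y2); last by rewrite /=; lia.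
have := Hrow y2.+1 ltac:(lia); have := Hcol x1.+1 ltac:(lia).
by rewrite lppSS /=; lia.
Qed.

(** [shadow_gap] provides one entry of [M] between any two consecutive cells, and [lpp_row_entry]
    one more in the row of the last cell. *)
Lemma shadow_chain_tail M p s : path antirel p s ->
  all (fun q => 0 < shadow M q.1 q.2) (p :: s) ->
  exists t, [/\ size t = (size s).+1, sorted antirel t,
    all (fun q => 0 < M q.1 q.2) t &
    all (fun q => (p.1 <= q.1 <= (last p s).1) && (q.2 < p.2)) t].
Proof.
elim: s p => [|q s IH] p /=.
  move=> _ /andP[Sp _].
  have /lpp_row_entry[y0 [y0lt My0 _]] : lpp M p.1 p.2 < lpp M p.1.+1 p.2.
    by move: Sp; rewrite /shadow; lia.
  by exists [:: (p.1, y0)]; split; rewrite //= ?andbT //; lia.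
move=> /andP[pq qs] /and3P[Sp Sq Ss].
have [|t [size_t sort_t pos_t bd_t]] := IH q qs; first by rewrite /= Sq.
have [z Mz Hz] := shadow_gap pq Sp Sq.
have lastq : q.1 <= (last q s).1.
  by case: t size_t bd_t {sort_t pos_t} => //= r t _ /andP[]; lia.
exists (z :: t); split.
- by rewrite /= size_t.
- rewrite /= path_min_sorted //; apply: sub_all bd_t => r; rewrite /antirel /=; lia.
- by rewrite /= Mz.
- rewrite /=; apply/andP; split; first by move: pq; rewrite /antirel; lia.
  by apply: sub_all bd_t => r; move: pq; rewrite /antirel /=; lia.
Qed.

Definition chain_below M (x y : nat) (s : seq (nat * nat)) : Prop :=
  [/\ sorted antirel s, all (fun q => 0 < M q.1 q.2) s &
      all (fun q => (q.1 <= x) && (q.2 <= y)) s].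

(** An entry in the column of the first cell is put before the chain of [shadow_chain_tail]: going
    back from [shadow M] to [M] gains one cell. *)
Lemma shadow_chain M x y p s : chain_below (shadow M) x y (p :: s) ->
  exists2 t, size t = (size s).+2 & chain_below M x y t.
Proof.
move=> [sort_s pos_s bd_s].
have [t [size_t sort_t pos_t bd_t]] := shadow_chain_tail sort_s pos_s.
have /lpp_col_entry[x0 [x0lt Mx0 _]] : lpp M p.1 p.2 < lpp M p.1 p.2.+1.
  by move: pos_s => /= /andP[]; rewrite /shadow; lia.
have bl : ((last p s).1 <= x) && (p.2 <= y).
  apply/andP; split; last by move: bd_s => /= /andP[]; lia.
  by have /(allP bd_s)/andP[] : last p s \in p :: s by exact: mem_last.
exists ((x0, p.2) :: t); first by rewrite /= size_t.
split.
- rewrite /= path_min_sorted //; apply: sub_all bd_t => r; rewrite /antirel /=; lia.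
- by rewrite /= Mx0.
- rewrite /=; apply/andP; split.
    by move: bd_s => /= /andP[]; lia.
  by apply: sub_all bd_t => r /=; lia.
Qed.

(** The direction of Greene's theorem that is used: a nonzero entry of the [r]-th shadow forces an
    antichain of [r.+1] entries, weakly below [(x, y)]. *)
Lemma iter_shadow_chain M r x y : 0 < iter r shadow M x y ->
  exists2 t, size t = r.+1 & chain_below M x y t.
Proof.
move=> Mr.
suff H q : q <= r ->
    exists2 t, size t = q.+1 & chain_below (iter (r - q) shadow M) x y t.
  by have := H r (leqnn r); rewrite subnn.
elim: q => [|q IH] lq.
  by exists [:: (x, y)] => //; split; rewrite /= ?subn0 ?Mr ?leqnn.
have [|[|p t] //= [size_t] ct] := IH; first exact: ltnW.
have e : r - q = (r - q.+1).+1 by lia.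
rewrite e /= in ct.
by have [t' st' ct'] := shadow_chain ct; exists t'; rewrite // st' size_t.
Qed.

End LastPassage.

(** * The inverse Burge local rule *)

Section BurgeRule.

(* Inverse local rule of the Burge variant of RSK: [l], [m], [v] are the shapes
   at three corners of a cell, [burge l m v] is the shape at the corner nearest
   to the origin and [carry l m v k] the entry of the cell, for shapes with at
   most [k] parts. *)

Implicit Types l m v p : nat -> nat.

Definition interlace p l : Prop :=
  forall r, p r <= l r /\ l r.+1 <= p r.

Fixpoint carry l m v (r : nat) : nat :=
  if r is r'.+1 then
    carry l m v r' + (l r - maxn (m r) (v r))
      - minn (carry l m v r') (minn (m r') (v r') - l r)
  else l 0 - maxn (m 0) (v 0).

Definition burge l m v (r : nat) : nat :=
  minn (m r) (v r) - minn (carry l m v r) (minn (m r) (v r) - l r.+1).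

Lemma burge_interlace l m v : interlace m l -> interlace v l ->
  interlace (burge l m v) m /\ interlace (burge l m v) v.
Proof.
move=> Hm Hv; split=> r; rewrite /burge; have := Hm r; have := Hv r;
by have := Hm r.+1; have := Hv r.+1; lia.
Qed.

(** The parts are recovered from the last to the first: part [r] of the output and the carry after
    row [r.+1] determine the carry after row [r] and the part [l r.+1]. *)
Lemma burge_inj k l l' m v : interlace m l -> interlace v l ->
  interlace m l' -> interlace v l' ->
  (forall r, k <= r -> l r = 0) -> (forall r, k <= r -> l' r = 0) ->
  (forall r, r < k -> burge l m v r = burge l' m v r) ->
  carry l m v k = carry l' m v k -> forall r, l r = l' r.
Proof.
move=> lm lv lm' lv' l0 l0' Eb Ec.
have H q : q <= k -> carry l m v (k - q) = carry l' m v (k - q) /\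
    forall r, k - q < r -> l r = l' r.
  elim: q => [|q IH] lq.
    rewrite subn0; split=> // r rk; rewrite l0 ?l0' //; lia.
  have [|Ec' El] := IH; first lia.
  have e : k - q = (k - q.+1).+1 by lia.
  have := Eb (k - q.+1) ltac:(lia); move: Ec'; rewrite e in El *.
  set r := k - q.+1 in El *; rewrite /burge /= => E1 E2.
  suff [Ecr Elr] : carry l m v r = carry l' m v r /\ l r.+1 = l' r.+1.
    split=> // j lj; have [->//|ne] := eqVneq j r.+1; apply: El.
    by rewrite ltn_neqAle eq_sym ne.
  have l_le : l r.+1 <= minn (m r) (v r) by rewrite leq_min (lm r).2 (lv r).2.
  have l'_le : l' r.+1 <= minn (m r) (v r) by rewrite leq_min (lm' r).2 (lv' r).2.
  have l_ge : maxn (m r.+1) (v r.+1) <= l r.+1 by rewrite geq_max (lm _).1 (lv _).1.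
  have l'_ge : maxn (m r.+1) (v r.+1) <= l' r.+1.
    by rewrite geq_max (lm' _).1 (lv' _).1.
  move: (minn (m r) (v r)) (maxn _ _) l_le l'_le l_ge l'_ge E1 E2 => a b.
  move: (carry l m v r) (carry l' m v r) (l r.+1) (l' r.+1) => x y p t; clear.
  by case: (leqP x (a - p)); case: (leqP y (a - t)); lia.
have [Ec0 El] := H k (leqnn k); rewrite subnn /= in Ec0 El.
move=> [|r]; last exact: El.
by have := lm 0; have := lv 0; have := lm' 0; have := lv' 0; lia.
Qed.

Lemma carry_eq0 l m v j k : interlace m l -> interlace v l ->
  j <= k -> (forall r, j < r -> l r = 0) -> carry l m v j = 0 ->
  carry l m v k = 0.
Proof.
move=> lm lv /subnK <- l0 c0; elim: (k - j) => [|q IH] //=.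
by rewrite IH l0; lia.
Qed.

Lemma interlace_noninc p l r j : interlace p l -> r <= j -> l j <= l r.
Proof.
move=> lp /subnK <-; elim: (j - r) => [|q IH] //; rewrite addSn.
by have := lp (q + r); lia.
Qed.

Lemma burge_row0 k l m v : interlace m l -> interlace v l ->
  0 < carry l m v k -> 0 < l 0.
Proof.
move=> lm lv; apply: contraTT; rewrite -!eqn0Ngt => /eqP l0.
apply/eqP/(@carry_eq0 _ _ _ 0) => //; last by rewrite /= l0.
move=> r _; have := interlace_noninc lm (leq0n r); lia.
Qed.

(** If [l r.+1] were zero, a positive output in row [r] would mean that the whole carry is absorbed
    there, and it would stay zero up to [k]. *)
Lemma burge_rowS k l m v r : interlace m l -> interlace v l -> r < k ->
  0 < carry l m v k -> 0 < burge l m v r -> 0 < l r.+1.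
Proof.
move=> lm lv rk ck b0; rewrite lt0n; apply/negP => /eqP l0.
have l0' j : r < j -> l j = 0.
  by move=> rj; have := interlace_noninc lm rj; lia.
suff c0 : carry l m v k = 0 by rewrite c0 in ck.
apply: (@carry_eq0 _ _ _ r.+1) => //; first by move=> j rj; apply: l0'; lia.
by move: b0; rewrite /burge /= l0; have := lm r; have := lv r; lia.
Qed.

Lemma burge_size k l m v : interlace m l -> interlace v l -> l k = 0 ->
  \sum_(r < k) l r + \sum_(r < k) burge l m v r =
  \sum_(r < k) m r + \sum_(r < k) v r + carry l m v k.
Proof.
move=> lm lv lk.
(* Row [q] of the output is not counted yet, whence the correction by [minn (m q) (v q)]; the second
   conjunct keeps the truncated subtraction exact. *)
have H q : q < k -> \sum_(r < q.+1) l r + \sum_(r < q) burge l m v r =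
   \sum_(r < q.+1) m r + \sum_(r < q.+1) v r + carry l m v q
   - minn (m q) (v q) /\ minn (m q) (v q) <= \sum_(r < q.+1) m r.
  elim: q => [|q IH] qk.
    rewrite !big_ord_recr !big_ord0 /=.
    by have := lm 0; have := lv 0; lia.
  have [|E L] := IH; first lia.
  rewrite [\sum_(r < q.+1) burge _ _ _ _]big_ord_recr /=.
  rewrite ![\sum_(r < q.+2) _]big_ord_recr /=.
  have := lm q; have := lv q; have := lm q.+1; have := lv q.+1.
  have : burge l m v q = minn (m q) (v q)
    - minn (carry l m v q) (minn (m q) (v q) - l q.+1) by [].
  move: E L; set Sb := \sum_(r < q) _; set Sl := \sum_(r < q.+1) l r.
  set Sm := \sum_(r < q.+1) m r; set Sv := \sum_(r < q.+1) v r.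
  by move: Sb Sl Sm Sv => Sb Sl Sm Sv; lia.
case: k lk H => [|k] lk H; first by rewrite !big_ord0 /=; have := lm 0; lia.
have [E L] := H k (leqnn _).
rewrite [\sum_(r < k.+1) burge _ _ _ _]big_ord_recr /=.
have : burge l m v k = minn (m k) (v k)
  - minn (carry l m v k) (minn (m k) (v k) - l k.+1) by [].
move: E L; set Sb := \sum_(r < k) _; set Sl := \sum_(r < k.+1) l r.
set Sm := \sum_(r < k.+1) m r; set Sv := \sum_(r < k.+1) v r.
move: Sb Sl Sm Sv => Sb Sl Sm Sv.
by have := lm k; have := lv k; rewrite /= lk; lia.
Qed.

End BurgeRule.

(** * Growth diagrams on the staircase *)

Section Rebuild.

Variables n k : nat.
Implicit Types (M : nat -> nat -> nat) (P : nat -> nat -> nat -> nat).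

Definition crossing_shape M (x y r : nat) : nat :=
  if r < k then lpp (iter r shadow M) x y else 0.

Lemma crossing_shape_interlacel M x y :
  interlace (crossing_shape M x y) (crossing_shape M x.+1 y).
Proof.
move=> r; rewrite /crossing_shape.
have := leq_lppl (iter r shadow M) x y.
have := lpp_interlacel (iter r shadow M) x y.
by rewrite iterS; case: ltnP => ?; case: ltnP => ? /=; lia.
Qed.

Lemma crossing_shape_interlacer M x y :
  interlace (crossing_shape M x y) (crossing_shape M x y.+1).
Proof.
move=> r; rewrite /crossing_shape.
have := leq_lppr (iter r shadow M) x y.
have := lpp_interlacer (iter r shadow M) x y.
by rewrite iterS; case: ltnP => ?; case: ltnP => ? /=; lia.
Qed.

Definition shadow_free M : Prop :=
  forall x y, x + y + 2 <= n -> iter k shadow M x y = 0.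

(** Recursion on the distance [d = n - (x + y)] to the boundary; the coordinate [y] is implicit in
    [d] and [x]. *)
Fixpoint rebuild_depth M (d : nat) : nat -> nat -> nat :=
  if d is d1.+1 then
    if d1 is d2.+1 then fun x =>
      burge (rebuild_depth M d2 x.+1) (rebuild_depth M d1 x.+1)
            (rebuild_depth M d1 x)
    else fun x => crossing_shape M x (n.-1 - x)
  else fun x => crossing_shape M x (n - x).

(* The shapes of the crossing growth diagram on the staircase
   [x + y \in {n - 1, n}], extended to the inner points by the inverse of the
   nesting growth rule. *)
Definition nesting_shape M (x y : nat) : nat -> nat :=
  rebuild_depth M (n - (x + y)) x.

Definition nesting_filling M (x y : nat) : nat :=
  if x + y + 2 <= n then
    carry (nesting_shape M x.+1 y.+1) (nesting_shape M x.+1 y)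
          (nesting_shape M x y.+1) k
  else 0.

Lemma nesting_shape_boundary M x y : x + y <= n <= x + y + 1 ->
  nesting_shape M x y = crossing_shape M x y.
Proof.
rewrite /nesting_shape => Hxy; have [e|e] : x + y = n \/ x + y + 1 = n by lia.
  have -> : n - (x + y) = 0 by lia.
  by rewrite /=; have -> : n - x = y by lia.
have -> : n - (x + y) = 1 by lia.
by rewrite /=; have -> : n.-1 - x = y by lia.
Qed.

Lemma nesting_shapeE M x y : x + y + 2 <= n ->
  nesting_shape M x y = burge (nesting_shape M x.+1 y.+1)
    (nesting_shape M x.+1 y) (nesting_shape M x y.+1).
Proof.
move=> Hxy; rewrite /nesting_shape.
have -> : n - (x + y) = (n - (x.+1 + y.+1)).+2 by lia.
have -> : n - (x.+1 + y) = (n - (x.+1 + y.+1)).+1 by lia.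
by have -> : n - (x + y.+1) = (n - (x.+1 + y.+1)).+1 by lia.
Qed.

Lemma nesting_shape_interlace M x y : x + y + 1 <= n ->
  interlace (nesting_shape M x y) (nesting_shape M x.+1 y) /\
  interlace (nesting_shape M x y) (nesting_shape M x y.+1).
Proof.
have [d] := ubnP (n - (x + y)); elim: d x y => // d IH x y ltd Hxy.
have [e|ne] := eqVneq (x + y + 1) n.
  rewrite !nesting_shape_boundary; try lia.
  by split; [exact: crossing_shape_interlacel | exact: crossing_shape_interlacer].
rewrite (@nesting_shapeE _ x y); last lia.
apply: burge_interlace.
  by have [||] := IH x.+1 y; [lia | lia |].
by have [||] := IH x y.+1; [lia | lia |].
Qed.

Lemma nesting_shape_ge M x y r : x + y <= n -> k <= r -> nesting_shape M x y r = 0.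
Proof.
have [d] := ubnP (n - (x + y)); elim: d x y => // d IH x y ltd Hxy kr.
have [b|nb] := boolP (x + y <= n <= x + y + 1).
  by rewrite nesting_shape_boundary // /crossing_shape ltnNge kr.
have [|+ _] := @nesting_shape_interlace M x y; first lia.
by move=> /(_ r)[]; rewrite (IH x.+1 y) //; lia.
Qed.

Lemma nesting_shape0y M y r : y <= n -> nesting_shape M 0 y r = 0.
Proof.
have [d] := ubnP (n - y); elim: d y => // d IH y ltd Hy.
have [b|nb] := boolP (y <= n <= y + 1).
  by rewrite nesting_shape_boundary // /crossing_shape lpp0y; case: ltnP.
have [|_] := @nesting_shape_interlace M 0 y; first lia.
by move=> /(_ r)[]; rewrite (IH y.+1) //; lia.
Qed.

Lemma nesting_shapex0 M x r : x <= n -> nesting_shape M x 0 r = 0.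
Proof.
have [d] := ubnP (n - x); elim: d x => // d IH x ltd Hx.
have [b|nb] := boolP (x <= n <= x + 1).
  by rewrite nesting_shape_boundary ?addn0 // /crossing_shape lppx0; case: ltnP.
have [|+ _] := @nesting_shape_interlace M x 0; first lia.
by move=> /(_ r)[]; rewrite (IH x.+1) //; lia.
Qed.

Lemma cell_interlace M x y : x + y + 2 <= n ->
  interlace (nesting_shape M x.+1 y) (nesting_shape M x.+1 y.+1) /\
  interlace (nesting_shape M x y.+1) (nesting_shape M x.+1 y.+1).
Proof.
move=> Hxy; split.
  by have [|] := @nesting_shape_interlace M x.+1 y; first lia.
by have [|] := @nesting_shape_interlace M x y.+1; first lia.
Qed.

(* The number of parts strictly increases along chains of nested edges, hence
   colours them properly. *)
Definition nesting_rows M (x y : nat) : nat :=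
  \sum_(r < k) (0 < nesting_shape M x y r).

Lemma nesting_rows_le M x y x' y' : x <= x' -> y <= y' -> x' + y' <= n ->
  nesting_rows M x y <= nesting_rows M x' y'.
Proof.
move=> lx ly Hn; apply: (@leq_trans (nesting_rows M x' y)).
  move: Hn; rewrite -(subnK lx); elim: (x' - x) => // i IH Hn.
  apply: leq_trans (IH _) _; first lia.
  apply: leq_sum => r _.
  have [|+ _] := @nesting_shape_interlace M (i + x) y; first lia.
  by move=> /(_ r)[]; rewrite addSn; lia.
move: Hn; rewrite -(subnK ly); elim: (y' - y) => // i IH Hn.
apply: leq_trans (IH _) _; first lia.
apply: leq_sum => r _.
have [|_] := @nesting_shape_interlace M x' (i + y); first lia.
by move=> /(_ r)[]; rewrite addSn; lia.
Qed.

(** By [burge_rowS] each nonzero part [r] at the inner corner yields a nonzero part [r.+1] at the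
    outer one, and by [burge_row0] the part of index 0 comes in addition. *)
Lemma nesting_rows_lt M x y : 0 < nesting_filling M x y ->
  nesting_rows M x y < nesting_rows M x.+1 y.+1.
Proof.
rewrite /nesting_filling; case: ifP => // Hxy ck.
have [lm lv] := cell_interlace M Hxy.
rewrite /nesting_rows nesting_shapeE //; set l := nesting_shape M x.+1 y.+1.
(* The zero part of index [k] is added to make room for the shift of indices. *)
apply: (@leq_trans (\sum_(r < k.+1) (0 < l r))); last first.
  rewrite big_ord_recr /= [X in _ + X](_ : _ = 0) ?addn0 //.
  by rewrite /l nesting_shape_ge //; lia.
rewrite big_ord_recl (burge_row0 lm lv ck) ltnS.
apply: leq_sum => r _; rewrite lift0.
case E : (0 < burge _ _ _ _) => //.
by rewrite (burge_rowS lm lv (ltn_ord r) ck).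
Qed.

Lemma nesting_rows_ltk M x y : 0 < nesting_filling M x y -> nesting_rows M x y < k.
Proof.
move=> Mp; apply: leq_trans (nesting_rows_lt Mp) _.
rewrite -[X in _ <= X]card_ord -sum1_card; apply: leq_sum => r _.
exact: leq_b1.
Qed.

Lemma nesting_rows_chain M x y x' y' : x < x' -> y < y' -> x' + y' + 2 <= n ->
  0 < nesting_filling M x y -> nesting_rows M x y < nesting_rows M x' y'.
Proof.
move=> lx ly Hn /nesting_rows_lt lt1; apply: leq_trans lt1 _.
by apply: nesting_rows_le; lia.
Qed.

(** The diagram is rebuilt outwards from the axes, where all shapes vanish: [burge_inj] finds the
    outer corner of a cell from its other corners and its entry. *)
Lemma eq_nesting_shape M1 M2 :
  (forall x y, x + y + 2 <= n ->
     nesting_filling M1 x y = nesting_filling M2 x y) ->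
  forall x y, x + y <= n -> forall r,
    nesting_shape M1 x y r = nesting_shape M2 x y r.
Proof.
move=> E x y; have [d] := ubnP (x + y); elim: d x y => // d IH x y ltd Hn r.
case: x ltd Hn => [|x] ltd Hn; first by rewrite !nesting_shape0y.
case: y ltd Hn => [|y] ltd Hn; first by rewrite !nesting_shapex0 // -(addn0 x.+1).
have Hxy : x + y + 2 <= n by lia.
have := E x y Hxy; rewrite /nesting_filling Hxy.
have [lm lv] := cell_interlace M1 Hxy; have [lm' lv'] := cell_interlace M2 Hxy.
have Em := IH x.+1 y ltac:(lia) ltac:(lia).
have Ev := IH x y.+1 ltac:(lia) ltac:(lia).
have Er := IH x y ltac:(lia) ltac:(lia).
have cong a m m' v v' : m =1 m' -> v =1 v' ->
    carry a m v =1 carry a m' v' /\ burge a m v =1 burge a m' v'.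
  move=> em ev; have ec : carry a m v =1 carry a m' v'.
    by elim=> [|i IHi] /=; rewrite ?IHi ?em ?ev.
  by split=> // i; rewrite /burge ec em ev.
have [cc cb] := cong (nesting_shape M2 x.+1 y.+1) _ _ _ _ Em Ev.
rewrite -cc => Ec.
apply: (burge_inj (k := k) lm lv _ _ _ _ _ Ec).
- by move=> i; rewrite Em; exact: lm'.
- by move=> i; rewrite Ev; exact: lv'.
- by move=> i ki; apply: nesting_shape_ge.
- by move=> i ki; apply: nesting_shape_ge.
- by move=> i ik; rewrite cb -!nesting_shapeE.
Qed.

(** Here the diagram is rebuilt inwards from the boundary. The outer corners of a cell determine the
    entries of all shadows of index below [k]; the [k]-th one is zero by [shadow_free]. The entry of
    each next shadow then gives a part at the inner corner. *)
Lemma crossing_shape_inj M1 M2 : shadow_free M1 -> shadow_free M2 ->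
  (forall x y, x + y <= n <= x + y + 1 ->
     crossing_shape M1 x y =1 crossing_shape M2 x y) ->
  forall x y, x + y <= n -> crossing_shape M1 x y =1 crossing_shape M2 x y /\
    (x + y + 2 <= n -> M1 x y = M2 x y).
Proof.
move=> F1 F2 E x y.
have [d] := ubnP (n - (x + y)); elim: d x y => // d IH x y ltd Hxy.
have [b|nb] := boolP (x + y <= n <= x + y + 1); first by split; [exact: E|lia].
have [El _] := IH x.+1 y.+1 ltac:(lia) ltac:(lia).
have [Em _] := IH x.+1 y ltac:(lia) ltac:(lia).
have [Ev _] := IH x y.+1 ltac:(lia) ltac:(lia).
have EM r : r <= k -> iter r shadow M1 x y = iter r shadow M2 x y.
  rewrite leq_eqVlt => /orP[/eqP->|rk]; first by rewrite F1 ?F2 //; lia.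
  have := El r; have := Em r; have := Ev r; rewrite /crossing_shape rk !lppSS.
  by move=> -> ->; lia.
split; last by move=> _; exact: (EM 0).
move=> r; rewrite /crossing_shape; case: ltnP => // rk.
have := EM r.+1 rk; rewrite !iterS !shadowE.
have := Em r; have := Ev r; rewrite /crossing_shape rk.
move: (leq_lppl (iter r shadow M1) x y) (leq_lppl (iter r shadow M2) x y).
move: (leq_lppr (iter r shadow M1) x y) (leq_lppr (iter r shadow M2) x y).
lia.
Qed.

Lemma nesting_filling_inj M1 M2 : shadow_free M1 -> shadow_free M2 ->
  (forall x y, x + y + 2 <= n ->
     nesting_filling M1 x y = nesting_filling M2 x y) ->
  forall x y, x + y + 2 <= n -> M1 x y = M2 x y.
Proof.
move=> F1 F2 /eq_nesting_shape E x y Hxy.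
have [||_ ->] // := crossing_shape_inj F1 F2 _ (x := x) (y := y); last lia.
move=> a b ab r; rewrite -!nesting_shape_boundary //; apply: E; lia.
Qed.

Lemma telescope_filling (A : nat -> nat -> nat) M x Y :
  A x 0 = 0 -> A x.+1 0 = 0 ->
  (forall y, y < Y -> A x.+1 y.+1 + A x y = A x y.+1 + A x.+1 y + M x y) ->
  \sum_(y < Y) M x y + A x Y = A x.+1 Y.
Proof.
move=> A0 A1; elim: Y => [|Y IH] H; first by rewrite big_ord0 A0 A1.
have := IH (fun y lt => H y (ltnW lt)); have := H Y (leqnn _).
by rewrite big_ord_recr /=; move: (\sum_(y < Y) _) => S; lia.
Qed.

(** The contribution of part [q] is the entry of the [q]-th shadow minus that of the next one. The
    sum telescopes, and its last term vanishes by [shadow_free]. *)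
Lemma crossing_shape_size M x y : shadow_free M -> x + y + 2 <= n ->
  \sum_(r < k) crossing_shape M x.+1 y.+1 r + \sum_(r < k) crossing_shape M x y r =
  \sum_(r < k) crossing_shape M x y.+1 r + \sum_(r < k) crossing_shape M x.+1 y r
  + M x y.
Proof.
move=> F Hxy.
have H q : q <= k -> \sum_(r < q) crossing_shape M x.+1 y.+1 r
    + \sum_(r < q) crossing_shape M x y r + iter q shadow M x y =
    \sum_(r < q) crossing_shape M x y.+1 r
    + \sum_(r < q) crossing_shape M x.+1 y r + M x y.
  elim: q => [|q IH] qk; first by rewrite !big_ord0.
  have Ec a b : crossing_shape M a b q = lpp (iter q shadow M) a b.
    by rewrite /crossing_shape qk.
  rewrite !big_ord_recr /=; move: {IH}(IH (ltnW qk)).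
  rewrite !Ec lppSS shadowE.
  move: (leq_lppl (iter q shadow M) x y) (leq_lppr (iter q shadow M) x y).
  move: (\sum_(i < q) crossing_shape M x.+1 y.+1 i) => S1.
  move: (\sum_(i < q) crossing_shape M x y i) => S2.
  move: (\sum_(i < q) crossing_shape M x.+1 y i) => S3.
  by move: (\sum_(i < q) crossing_shape M x y.+1 i) => S4; lia.
by rewrite -(H k (leqnn k)) F // addn0.
Qed.

(** For each fixed [x] both inner sums equal the same difference of sizes of two boundary shapes,
    which the two diagrams share. *)
Lemma nesting_filling_size M : shadow_free M ->
  \sum_(x < n) \sum_(y < n.-1 - x) nesting_filling M x y =
  \sum_(x < n) \sum_(y < n.-1 - x) M x y.
Proof.
move=> F; apply: eq_bigr => -[x xn] _ /=.
have e1 := @telescope_filling (fun x y => \sum_(r < k) crossing_shape M x y r)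
  M x (n.-1 - x).
have e2 := @telescope_filling (fun x y => \sum_(r < k) nesting_shape M x y r)
  (nesting_filling M) x (n.-1 - x).
have {e1}e1 := e1 ltac:(by rewrite big1 // => r _; rewrite /crossing_shape lppx0; case: ltnP)
  ltac:(by rewrite big1 // => r _; rewrite /crossing_shape lppx0; case: ltnP)
  ltac:(by move=> y Hy; apply: crossing_shape_size => //; lia).
have {e2}e2 := e2 ltac:(by rewrite big1 // => r _; rewrite nesting_shapex0 //; lia)
  ltac:(by rewrite big1 // => r _; rewrite nesting_shapex0 //; lia).
suff /e2 {}e2 : forall y, y < n.-1 - x ->
    \sum_(r < k) nesting_shape M x.+1 y.+1 r + \sum_(r < k) nesting_shape M x y r
    = \sum_(r < k) nesting_shape M x y.+1 r
      + \sum_(r < k) nesting_shape M x.+1 y r + nesting_filling M x y.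
  move: e2; rewrite !nesting_shape_boundary; try lia.
  by rewrite -e1 => /addIn.
move=> y Hy; have Hxy : x + y + 2 <= n by lia.
rewrite (nesting_shapeE _ Hxy) /nesting_filling Hxy.
have [lm lv] := cell_interlace M Hxy.
rewrite burge_size //; first by rewrite [X in X + _]addnC.
by apply: nesting_shape_ge; lia.
Qed.

End Rebuild.

(** * Edge multisets as fillings of a staircase *)

Section EdgeFillings.

Variables n k : nat.
Local Notation N := #|{: edge n}|.
Implicit Types (e f : edge n) (m : 'X_{1..N}).

Definition mult m e : nat := m (enum_rank e).

(* The edge {i, j} is put in the cell (i, n - 1 - j), so that crossing edges
   form antichains and nested edges form chains for the product order. *)
Definition colpos e : nat := (val e).1.
Definition rowpos e : nat := n.-1 - (val e).2.

Lemma edge_lt e : (val e).1 < (val e).2.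
Proof. exact: (valP e). Qed.

Lemma crossesE e f : crosses e f =
  [&& (val e).1 < (val f).1, (val f).1 < (val e).2 & (val e).2 < (val f).2]
  || [&& (val f).1 < (val e).1, (val e).1 < (val f).2 & (val f).2 < (val e).2].
Proof. by rewrite /crosses; case: (val e) (val f) => [a b] [c d]. Qed.

Lemma edge_pos e : colpos e + rowpos e + 2 <= n.
Proof.
rewrite /colpos /rowpos; have := edge_lt e; have := ltn_ord (val e).2; lia.
Qed.

Lemma edge_pos_inj e f : colpos e = colpos f -> rowpos e = rowpos f -> e = f.
Proof.
rewrite /colpos /rowpos => e1 e2; apply: val_inj.
have lt1 := ltn_ord (val e).2; have lt2 := ltn_ord (val f).2.
case: (val e) (val f) e1 e2 lt1 lt2 => [a b] [c d] /= /ord_inj-> E lt1 lt2.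
by congr pair; apply: ord_inj; lia.
Qed.

Lemma edge_at x y : x + y + 2 <= n ->
  exists e, colpos e = x /\ rowpos e = y.
Proof.
move=> Hxy; have xn : x < n by lia.
have yn : n.-1 - y < n by lia.
have lt : Ordinal xn < Ordinal yn by rewrite /=; lia.
by exists (mkedge lt); rewrite /colpos /rowpos /=; lia.
Qed.

(** The sum has at most one term by [edge_pos_inj], and none outside the staircase, where the
    filling is therefore zero. *)
Definition filling m (x y : nat) : nat :=
  \sum_(e | (colpos e == x) && (rowpos e == y)) mult m e.

Definition filling_mnm (M : nat -> nat -> nat) : 'X_{1..N} :=
  [multinom M (colpos (enum_val i)) (rowpos (enum_val i)) | i < N].

Lemma filling_edge m e : filling m (colpos e) (rowpos e) = mult m e.
Proof.
rewrite /filling (bigD1 e) ?eqxx //= big1 ?addn0 // => f.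
case/andP=> /andP[/eqP e1 /eqP e2] /eqP[]; exact: edge_pos_inj.
Qed.

Lemma filling_gt0 m x y : 0 < filling m x y ->
  exists e, [/\ colpos e = x, rowpos e = y & 0 < mult m e].
Proof.
rewrite lt0n sum_nat_eq0 => /forallPn[e]; rewrite negb_imply.
by case/andP=> /andP[/eqP e1 /eqP e2] e3; exists e; rewrite lt0n.
Qed.

Lemma mult_filling M e : mult (filling_mnm M) e = M (colpos e) (rowpos e).
Proof. by rewrite /mult mnmE enum_rankK. Qed.

Lemma mult_inj m m' : mult m =1 mult m' -> m = m'.
Proof.
by move=> E; apply/mnmP => i; have := E (enum_val i); rewrite /mult enum_valK.
Qed.

Lemma mdeg_mult m : mdeg m = \sum_(e : edge n) mult m e.
Proof.
by rewrite mdegE (reindex _ (onW_bij _ (@enum_rank_bij (edge n)))).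
Qed.

Lemma mdeg_filling m :
  mdeg m = \sum_(x < n) \sum_(y < n.-1 - x) filling m x y.
Proof.
rewrite mdeg_mult (partition_big (fun e => (val e).1) predT) //=.
apply: eq_bigr => x _; case E: (n.-1 - x) => [|q].
  rewrite big_ord0 big1 // => e /eqP ex.
  by have := edge_pos e; rewrite /colpos ex; lia.
rewrite (partition_big (fun e => inord (rowpos e) : 'I_q.+1) predT) //=.
apply: eq_bigr => y _; apply: eq_bigl => e; rewrite /colpos -val_eqE /=.
case: eqVneq => //= ex; rewrite -val_eqE /= inordK //.
by have := edge_pos e; rewrite /colpos ex; lia.
Qed.

Definition has_crossing m : bool :=
  [exists C : {set edge n}, is_crossing k.+1 C && [forall e in C, 0 < mult m e]].

Definition nests e f : bool :=
  ((val e).1 < (val f).1) && ((val f).2 < (val e).2).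

Definition nest_coloring m (col : edge n -> 'I_k) : Prop :=
  forall e f, 0 < mult m e -> 0 < mult m f -> nests e f -> col e != col f.

Definition nest_colorable m : bool :=
  [exists col : {ffun edge n -> 'I_k},
     [forall e, forall f, [&& 0 < mult m e, 0 < mult m f & nests e f]
        ==> (col e != col f)]].

Lemma nest_colorableP m :
  reflect (exists col, nest_coloring m col) (nest_colorable m).
Proof.
apply: (iffP existsP) => [[col H]|[col H]].
  exists col => e f e0 f0 ef; move/forallP/(_ e)/forallP/(_ f)/implyP: H.
  by apply; rewrite e0 f0.
exists (finfun col); apply/forallP => e; apply/forallP => f; apply/implyP.
by rewrite !ffunE => /and3P[]; exact: H.
Qed.

Lemma sorted_antirel_cmp s p q : sorted antirel s -> p \in s -> q \in s ->
  p != q -> antirel p q || antirel q p.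
Proof.
move=> sort_s ps qs ne; have := ne.
rewrite -(nth_index p ps) -(nth_index p qs).
have lt1 := ps; have lt2 := qs; rewrite -index_mem in lt1; rewrite -index_mem in lt2.
have mono := sorted_ltn_nth antirel_trans p sort_s.
have [lt|gt|->] := ltngtP (index p s) (index q s); last by rewrite eqxx.
  by move=> _; apply/orP; left; apply: mono.
by move=> _; apply/orP; right; apply: mono.
Qed.

(** An entry would give an antichain of [k.+1] cells weakly below [(x, y)]. As [x + y + 2 <= n],
    every left end then precedes every right end, so that the corresponding edges cross pairwise. *)
Lemma filling_shadow_free m : ~~ has_crossing m -> shadow_free n k (filling m).
Proof.
move=> Nm x y Hxy; apply/eqP; rewrite eqn0Ngt; apply: contra Nm => Mp.
have [t size_t [sort_t pos_t bd_t]] := iter_shadow_chain Mp.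
apply/existsP; exists [set e | (colpos e, rowpos e) \in t].
have irr : irreflexive antirel by move=> p; rewrite /antirel; lia.
have uniq_t := sorted_uniq antirel_trans irr sort_t.
apply/andP; split; last first.
  apply/forall_inP => e; rewrite inE => et.
  by have := allP pos_t _ et; rewrite /= filling_edge.
apply/andP; split.
  rewrite cardE -size_t -(size_map (fun e => (colpos e, rowpos e))).
  apply/eqP/perm_size/uniq_perm => //.
    rewrite map_inj_uniq ?enum_uniq // => e f [e1 e2]; exact: edge_pos_inj.
  move=> [a b]; apply/mapP/idP => [[e]|ab].
    by rewrite mem_enum inE => et ->.
  have /filling_gt0[e [e1 e2 e3]] := allP pos_t _ ab.
  by exists e; rewrite ?mem_enum ?inE e1 e2.
apply/forall_inP => e; rewrite inE => et; apply/forall_inP => f; rewrite inE => ft.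
apply/implyP => ef.
have ne : (colpos e, rowpos e) != (colpos f, rowpos f).
  apply: contra ef => /eqP[e1 e2]; apply/eqP; exact: edge_pos_inj.
have := allP bd_t _ et; have := allP bd_t _ ft.
have := sorted_antirel_cmp sort_t et ft ne.
rewrite /antirel /colpos /rowpos crossesE /=.
by have := ltn_ord (val e).2; have := ltn_ord (val f).2; rewrite /=; lia.
Qed.

Definition uncross m : 'X_{1..N} := filling_mnm (nesting_filling n k (filling m)).

Lemma uncross_colorable m : 0 < k -> nest_colorable (uncross m).
Proof.
move=> k0; apply/nest_colorableP; pose M := filling m.
(* The colour is the number of nonzero parts at the inner corner of the cell; it is below [k] on the
   support, so the default is only taken off the support. *)
exists (fun e => insubd (Ordinal k0) (nesting_rows n k M (colpos e) (rowpos e))).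
move=> e f; rewrite /uncross !mult_filling -/M => e0 f0 ef.
rewrite -val_eqE /= !val_insubd !nesting_rows_ltk //.
rewrite neq_ltn nesting_rows_chain //.
- by case/andP: ef.
- case/andP: ef; rewrite /rowpos; have := ltn_ord (val e).2; lia.
- exact: edge_pos.
Qed.

Lemma filling_uncross m x y : x + y + 2 <= n ->
  filling (uncross m) x y = nesting_filling n k (filling m) x y.
Proof.
by move=> /edge_at[e [<- <-]]; rewrite filling_edge mult_filling.
Qed.

Lemma mdeg_uncross m : ~~ has_crossing m -> mdeg (uncross m) = mdeg m.
Proof.
move=> Nm; rewrite !mdeg_filling -(nesting_filling_size (filling_shadow_free Nm)).
apply: eq_bigr => x _; apply: eq_bigr => y _; apply: filling_uncross.
have := ltn_ord x; have := ltn_ord y; lia.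
Qed.

Lemma uncross_inj m m' : ~~ has_crossing m -> ~~ has_crossing m' ->
  uncross m = uncross m' -> m = m'.
Proof.
move=> Nm Nm' E; apply: mult_inj => e; rewrite -!filling_edge.
apply: (nesting_filling_inj (filling_shadow_free Nm) (filling_shadow_free Nm')).
  by move=> x y Hxy; rewrite -!filling_uncross // E.
exact: edge_pos.
Qed.

(** Complementary form of the injection [uncross] from crossing-free to nest-colourable monomials;
    the degree bound makes both sets finite. *)
Lemma card_crossing_ge D : 0 < k ->
  #|[set b : 'X_{1..N < D} | ~~ nest_colorable b]|
    <= #|[set b : 'X_{1..N < D} | has_crossing b]|.
Proof.
move=> k0.
suff : #|[set b : 'X_{1..N < D} | ~~ has_crossing b]|
    <= #|[set b : 'X_{1..N < D} | nest_colorable b]|.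
  have := cardsC [set b : 'X_{1..N < D} | has_crossing b].
  have := cardsC [set b : 'X_{1..N < D} | nest_colorable b].
  have -> : ~: [set b : 'X_{1..N < D} | nest_colorable b] =
    [set b : 'X_{1..N < D} | ~~ nest_colorable b] by apply/setP => b; rewrite !inE.
  have -> : ~: [set b : 'X_{1..N < D} | has_crossing b] =
    [set b : 'X_{1..N < D} | ~~ has_crossing b] by apply/setP => b; rewrite !inE.
  lia.
pose h (b : 'X_{1..N < D}) := insubd b (uncross b).
have hE (b : 'X_{1..N < D}) : ~~ has_crossing b -> h b = uncross b :> 'X_{1..N}.
  by move=> Nb; rewrite /h val_insubd mdeg_uncross // bmdeg.
rewrite -(card_in_imset (f := h)).
  apply: subset_leq_card; apply/subsetP => _ /imsetP[b + ->].
  by rewrite !inE => Nb; rewrite hE // uncross_colorable.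
move=> b c; rewrite !inE => Nb Nc E; apply: val_inj; apply: uncross_inj => //.
by rewrite -!hE // E.
Qed.

End EdgeFillings.

(** Each orbit is a pair, split by comparing the ranks of [x] and [s x]. This works in
    characteristic 2 as well, where showing that the sum equals its opposite would prove nothing. *)
Lemma sum_involution (R : zmodType) (T : finType) (P : pred T) (F : T -> R)
    (s : T -> T) :
  (forall x, P x -> P (s x)) -> (forall x, P x -> s (s x) = x) ->
  (forall x, P x -> s x != x) -> (forall x, P x -> F (s x) = - F x)%R ->
  (\sum_(x | P x) F x = 0)%R.
Proof.
move=> Ps ss sx Fs; pose Q x := enum_rank x < enum_rank (s x).
rewrite (bigID Q) /= [X in (_ + X)%R](reindex_onto s s) /=; last first.
  by move=> i /andP[/ss].
rewrite [X in (_ + X)%R](eq_bigl (fun x => P x && Q x)); last first.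
  move=> x; apply/andP/andP => [[/andP[Psx NQ] /eqP ssx]|[Px Qx]].
    have Px : P x by rewrite -ssx; apply: Ps.
    split=> //; move: NQ; rewrite /Q ssx -leqNgt leq_eqVlt => /orP[|//].
    by move/eqP/ord_inj/enum_rank_inj => E; have := sx x Px; rewrite -E eqxx.
  by rewrite ss // Ps //= /Q ss // -leqNgt; split=> //; apply: ltnW.
rewrite -big_split big1 //= => x /andP[Px _]; by rewrite Fs // GRing.addrN.
Qed.

(** * Perfect matchings and the vanishing of Pfaffians of low rank *)

Section Matchings.

Variable n : nat.
Implicit Types (e f g : edge n) (E C : {set edge n}) (U : {set 'I_n}).

Lemma in_ends e x : (x \in ends e) = (x == (val e).1) || (x == (val e).2).
Proof. by rewrite /ends !inE. Qed.

Lemma ends_ordered e p x : ends e = [set p; x] ->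
  p != x /\ val e = (if p < x then (p, x) else (x, p)).
Proof.
move=> E; have lt_e := edge_lt e.
have pe : p \in ends e by rewrite E set21.
have xe : x \in ends e by rewrite E set22.
have e1 : (val e).1 \in [set p; x] by rewrite -E in_ends eqxx.
have e2 : (val e).2 \in [set p; x] by rewrite -E in_ends eqxx orbT.
move: lt_e e1 e2 pe xe; rewrite !in_ends !inE; case: (val e) => [a b] /=.
move=> ab /orP[]/eqP ea /orP[]/eqP eb _ _; rewrite ea eb ?ltnn // in ab *.
  by rewrite ab -val_eqE /=; split=> //; lia.
by rewrite ltnNge (ltnW ab) -val_eqE /=; split=> //; lia.
Qed.

Lemma ends_inj : injective (@ends n).
Proof.
move=> e f E; have Ef : ends f = [set (val f).1; (val f).2] by [].
rewrite -E in Ef; have [_ ve] := ends_ordered Ef.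
by apply: val_inj; rewrite ve edge_lt; case: (val f).
Qed.

Lemma ends_other e p : p \in ends e -> exists2 x, p != x & ends e = [set p; x].
Proof.
rewrite in_ends => /orP[]/eqP ->.
  by exists (val e).2 => //; rewrite -val_eqE neq_ltn edge_lt.
exists (val e).1; first by rewrite -val_eqE neq_ltn edge_lt orbT.
by rewrite /ends setUC.
Qed.

Lemma card_ends e : #|ends e| = 2.
Proof. by rewrite cards2 -val_eqE neq_ltn edge_lt. Qed.

Lemma perfect_matchingP U E :
  reflect [/\ forall e, e \in E -> ends e \subset U,
      forall u, u \in U -> exists2 e, e \in E & u \in ends e &
      forall e f u, e \in E -> f \in E -> u \in ends e -> u \in ends f -> e = f]
    (perfect_matching U E).
Proof.
apply: (iffP and3P) => [[/eqP cov triv _]|[H1 H2 H3]].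
  split=> [e eE|u|e f u eE fE ue uf].
  - by rewrite -cov /cover; apply: (bigcup_max (ends e)); rewrite ?imset_f.
  - by rewrite -cov => /bigcupP[_ /imsetP[e eE ->] ue]; exists e.
  - apply: ends_inj; rewrite -(def_pblock triv (imset_f _ eE) ue).
    exact: (def_pblock triv (imset_f _ fE) uf).
split.
- apply/eqP/setP => u; apply/bigcupP/idP => [[_ /imsetP[e eE ->]]|].
    exact: (subsetP (H1 e eE)).
  by move=> /H2[e eE ue]; exists (ends e) => //; apply: imset_f.
- apply/trivIsetP => _ _ /imsetP[e eE ->] /imsetP[f fE ->] ne.
  apply/pred0P => u /=; apply/negbTE/negP => /andP[ue uf].
  by rewrite (H3 _ _ _ eE fE ue uf) eqxx in ne.
- apply/negP => /imsetP[e _ E0]; have := card_ends e; by rewrite -E0 cards0.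
Qed.

Lemma card_perfect_matching U E : perfect_matching U E -> #|U| = 2 * #|E|.
Proof.
have card2 : {in (@ends n) @: E, forall A : {set 'I_n}, #|A| = 2}.
  by move=> _ /imsetP[e _ ->]; apply: card_ends.
move=> PM; rewrite (card_uniform_partition card2 PM) mulnC.
by rewrite (card_imset (mem E) (@ends_inj)).
Qed.

Lemma crossesC e f : crosses e f = crosses f e.
Proof. by rewrite !crossesE orbC. Qed.

Lemma crosses_irr e : crosses e e = false.
Proof. by rewrite crossesE; lia. Qed.

Lemma is_crossing2 e f : is_crossing 2 [set e; f] = crosses e f.
Proof.
apply/andP/idP => [[ef /forall_inP/(_ e)]|ef].
  rewrite set21 => /(_ isT)/forall_inP/(_ f).
  rewrite set22 => /(_ isT)/implyP; apply.
  by move: ef; rewrite cards2; case: (e != f).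
have ne : e != f by apply: contraTneq ef => ->; rewrite crosses_irr.
rewrite cards2 ne; split=> //.
apply/forall_inP => g /set2P gE; apply/forall_inP => h /set2P hE.
apply/implyP => gh; case: gE gh => ->; case: hE => ->; rewrite ?eqxx //.
by rewrite crossesC.
Qed.

Definition crossing_number e E : nat := \sum_(g in E) crosses e g.

Lemma cr_setU1 e E : e \notin E -> cr (e |: E) = cr E + crossing_number e E.
Proof.
move=> eE; rewrite /cr /crossing_number.
have -> : [set D in powerset (e |: E) | is_crossing 2 D] =
    [set D in powerset E | is_crossing 2 D] :|:
    [set [set e; g] | g in [set g in E | crosses e g]].
  apply/setP => D; rewrite !inE; apply/andP/orP => [[sD cD]|].
    have [eD|eD] := boolP (e \in D); last first.
      left; rewrite cD andbT; apply/subsetP => g gD.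
      have := subsetP sD g gD; rewrite !inE => /orP[/eqP E1|//].
      by rewrite -E1 gD in eD.
    right; have /cards2P[a [b [ab eDab]]] : #|D| == 2 by case/andP: cD.
    have [g eg D_eg] : exists2 g, e != g & D = [set e; g].
      move: eD; rewrite eDab => /set2P[]->; first by exists b.
      by exists a; rewrite 1?eq_sym // setUC.
    apply/imsetP; exists g => //; rewrite inE -is_crossing2 -D_eg cD andbT.
    have := subsetP sD g; rewrite D_eg set22 !inE => /(_ isT).
    by rewrite eq_sym (negbTE eg).
  case=> [/andP[sD cD]|/imsetP[g]].
    by split=> //; apply: subset_trans sD _; apply: subsetUr.
  rewrite inE => /andP[gE cg] ->; rewrite is_crossing2 cg; split=> //.
  by apply/subsetP => h /set2P[]->; rewrite !inE ?eqxx ?gE ?orbT.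
rewrite cardsU [X in _ - X]eq_card0 ?subn0; last first.
  move=> D; rewrite !inE; apply/negP => /andP[/andP[sD _] /imsetP[g _ Dg]].
  by have := subsetP sD e; rewrite Dg set21 (negbTE eE) => /(_ isT).
congr (_ + _); rewrite card_in_imset; last first.
  move=> g h; rewrite !inE => /andP[gE _] /andP[hE _] E1.
  have : g \in [set e; h] by rewrite -E1 set22.
  by case/set2P => // E2; rewrite -E2 gE in eE.
rewrite -sum1_card big_mkcond /= [RHS]big_mkcond /=.
by apply: eq_bigr => g _; rewrite inE; case: (g \in E); case: (crosses e g).
Qed.

(** Two chords without a common end cross exactly when one separates the ends of the other. *)
Lemma ends_crosses_parity e g p x : ends e = [set p; x] ->
  p \notin ends g -> x \notin ends g ->
  crosses e g = ((val g).1 < p < (val g).2) (+) ((val g).1 < x < (val g).2).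
Proof.
move=> /ends_ordered[px ve]; rewrite !in_ends crossesE ve -!val_eqE /=.
rewrite -val_eqE /= in px; have := edge_lt g.
by case: (ltnP p x) => /= ? ? ? ?; lia.
Qed.

End Matchings.

(** * Action of vertex permutations on matchings *)

Section Relabel.

Variable n : nat.
Implicit Types (e f g : edge n) (E C : {set edge n}) (U : {set 'I_n}).
Implicit Types (s : {perm 'I_n}) (p q x y : 'I_n).

(** The default [e] of [insubd] is never taken, since a permutation keeps the two ends distinct. *)
Definition relabel s e : edge n :=
  insubd e (if s (val e).1 < s (val e).2 then (s (val e).1, s (val e).2)
            else (s (val e).2, s (val e).1)).

Lemma ends_relabel s e : ends (relabel s e) = s @: ends e.
Proof.
have ne : s (val e).1 != s (val e).2 :> nat.
  by rewrite val_eqE (inj_eq perm_inj) -val_eqE neq_ltn edge_lt.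
rewrite /ends /relabel val_insubd !imsetU !imset_set1.
case: (ltnP (s (val e).1) (s (val e).2)) => [lt_s|le_s] /=; first by rewrite lt_s.
by rewrite ltn_neqAle eq_sym ne le_s /= setUC.
Qed.

Lemma ends_relabel_tperm p q e x : ends e = [set p; x] -> x != q ->
  ends (relabel (tperm p q) e) = [set q; x].
Proof.
move=> E xq; have [px _] := ends_ordered E.
by rewrite ends_relabel E imsetU !imset_set1 tpermL tpermD // eq_sym.
Qed.

Lemma relabel_tpermK p q : involutive (relabel (tperm p q)).
Proof.
move=> e; apply: ends_inj; rewrite !ends_relabel -imset_comp.
rewrite (eq_imset _ (g := id)) ?imset_id // => x; exact: tpermK.
Qed.

Lemma relabel_tperm_id p q e : p \notin ends e -> q \notin ends e ->
  relabel (tperm p q) e = e.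
Proof.
move=> pe qe; apply: ends_inj; rewrite ends_relabel.
rewrite (eq_in_imset (g := id)) ?imset_id // => x xe.
by rewrite tpermD //; apply: contraTneq xe => <-.
Qed.

Lemma relabel_perfect_matching s U E : s @: U = U ->
  perfect_matching U E -> perfect_matching U (relabel s @: E).
Proof.
move=> sU /perfect_matchingP[H1 H2 H3].
apply/perfect_matchingP; split.
- move=> _ /imsetP[e eE ->]; rewrite ends_relabel -sU.
  by apply: imsetS; apply: H1.
- move=> u; rewrite -sU => /imsetP[w wU ->]; have [e eE we] := H2 w wU.
  by exists (relabel s e); rewrite ?imset_f // ends_relabel imset_f.
- move=> _ _ u /imsetP[e eE ->] /imsetP[f fE ->]; rewrite !ends_relabel.
  move=> /imsetP[w we ->] /imsetP[w' we' /perm_inj E1].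
  by rewrite (H3 e f w) // E1.
Qed.

Lemma tperm_imset p q U : p \in U -> q \in U -> tperm p q @: U = U.
Proof.
move=> pU qU; have sub : tperm p q @: U \subset U.
  by apply/subsetP => _ /imsetP[x xU ->]; have [_|_|_ _] := tpermP p q x.
by apply/eqP; rewrite eqEcard sub (card_imset _ (@perm_inj _ _)) /=.
Qed.

Lemma tperm_perfect_matching p q U E : p \in U -> q \in U ->
  perfect_matching U E -> perfect_matching U (relabel (tperm p q) @: E).
Proof. by move=> pU qU; apply: relabel_perfect_matching; apply: tperm_imset. Qed.

(** Unless [p] is matched to [q], transposing them moves exactly the two edges [e] and [f] and fixes
    the rest [E0]. *)
Lemma split_matching p q U E : p \in U -> q \in U -> p != q ->
  perfect_matching U E ->
  (exists2 e, e \in E & ends e = [set p; q]) \/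
  exists e f x y (E0 : {set edge n}), [/\ E = e |: (f |: E0), e != f, e \notin E0, f \notin E0
    & [/\ ends e = [set p; x], ends f = [set q; y], uniq [:: p; q; x; y]
       & forall g, g \in E0 -> [/\ p \notin ends g, q \notin ends g,
           x \notin ends g & y \notin ends g]]].
Proof.
move=> pU qU pq /perfect_matchingP[_ H2 H3].
have [e eE pe] := H2 p pU; have [f fE qf] := H2 q qU.
have [x px Ee] := ends_other pe; have [y qy Ef] := ends_other qf.
have [ef|ef] := eqVneq e f.
  left; exists e => //; move: qf; rewrite -ef Ee => /set2P[E1|-> //].
  by rewrite E1 eqxx in pq.
right; exists e, f, x, y, (E :\ e :\ f); split.
- by rewrite setD1K ?setD1K // !inE eq_sym ef.
- exact: ef.
- by rewrite !inE eqxx andbF.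
- by rewrite !inE eqxx.
split=> //.
  rewrite /= !inE !negb_or pq px /= qy /= andbT.
  have N z : z \in ends e -> z \notin ends f.
    by move=> ze; apply: contra ef => zf; rewrite (H3 e f z).
  have xe : x \in ends e by rewrite Ee set22.
  have := N p pe; have := N x xe; rewrite Ef !inE !negb_or.
  by move=> /andP[xq xy] /andP[_ py]; rewrite py xy andbT eq_sym xq.
move=> g; rewrite !in_setD1 => /and3P[gf ge gE].
have N z h : h \in E -> g != h -> z \in ends h -> z \notin ends g.
  by move=> hE gh zh; apply: contra gh => zg; rewrite (H3 g h z).
by split; [apply: (N p e)|apply: (N q f)|apply: (N x e)|apply: (N y f)];
  rewrite ?Ee ?Ef ?set21 ?set22.
Qed.

Lemma relabel_split p q x y e f (E0 : {set edge n}) :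
  ends e = [set p; x] -> ends f = [set q; y] -> uniq [:: p; q; x; y] ->
  (forall g, g \in E0 -> p \notin ends g /\ q \notin ends g) ->
  relabel (tperm p q) @: (e |: (f |: E0)) =
  relabel (tperm p q) e |: (relabel (tperm p q) f |: E0).
Proof.
move=> Ee Ef U4 H0; rewrite !imsetU !imset_set1; congr (_ |: (_ |: _)).
rewrite (eq_in_imset (g := id)) ?imset_id // => g /H0[pg qg].
exact: relabel_tperm_id.
Qed.

Lemma uniq4 (T : eqType) (a b c d : T) : uniq [:: a; b; c; d] ->
  [/\ a != b, a != c, a != d, b != c & b != d /\ c != d].
Proof.
rewrite /= !inE !negb_or andbT -!andbA.
by move=> /and5P[-> -> -> -> /andP[-> ->]].
Qed.

End Relabel.

(** * Pfaffians with two equal rows *)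

Section Alternating.

Variables (R : comNzRingType) (n : nat) (B : 'I_n -> 'I_n -> R).
Implicit Types (e f g : edge n) (E C : {set edge n}) (U : {set 'I_n}).
Implicit Types (p q x y : 'I_n).

(** The Pfaffian of the submatrix of [B] indexed by [U], when [B] is alternating. *)
Definition matching_sum U : R :=
  (\sum_(E : {set edge n} | perfect_matching U E)
     (-1) ^+ cr E * \prod_(e in E) B (val e).1 (val e).2)%R.

Hypothesis B_alt : (forall i, B i i = 0)%R.
Hypothesis B_anti : (forall i j, B i j = - B j i)%R.

Lemma edge_entry e p x : ends e = [set p; x] ->
  (B (val e).1 (val e).2 = (-1) ^+ (x < p) * B p x)%R.
Proof.
move=> /ends_ordered[px ->]; rewrite -val_eqE /= in px.
case: ltngtP px => //= lt _; rewrite ?expr0 ?mul1r //.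
by rewrite expr1 mulN1r -B_anti.
Qed.

(** A finite check over the relative orders of the four ends: the signs from orienting the two
    edges, times the sign of their mutual crossing, change under the swap. *)
Lemma swap_parity p q x y e f e' f' : uniq [:: p; q; x; y] ->
  ends e = [set p; x] -> ends f = [set q; y] ->
  ends e' = [set q; x] -> ends f' = [set p; y] ->
  odd ((x < p) + (y < q) + crosses e f) =
  ~~ odd ((x < q) + (y < p) + crosses e' f').
Proof.
move=> U4 /ends_ordered[_ Ee] /ends_ordered[_ Ef].
move=> /ends_ordered[_ Ee'] /ends_ordered[_ Ef'].
rewrite !crossesE Ee Ef Ee' Ef'; move: U4; rewrite /= !inE !negb_or andbT -!val_eqE /=.
case: (ltngtP p x); case: (ltngtP q y); case: (ltngtP q x);
  case: (ltngtP p y) => //= ? ? ? ? H; lia.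
Qed.

Lemma signr_flip a b : odd a = ~~ odd b -> ((-1) ^+ a = - (-1) ^+ b :> R)%R.
Proof.
by move=> E; rewrite -signr_odd E -(signr_odd _ b) signrN.
Qed.

(** By [ends_crosses_parity] both parities depend only on which of the four ends lie inside [g], and
    the swap keeps these ends. *)
Lemma third_edge_parity p q x y e f e' f' g :
  ends e = [set p; x] -> ends f = [set q; y] ->
  ends e' = [set q; x] -> ends f' = [set p; y] ->
  [/\ p \notin ends g, q \notin ends g, x \notin ends g & y \notin ends g] ->
  odd (crosses e g + crosses f g) = odd (crosses e' g + crosses f' g).
Proof.
move=> Ee Ef Ee' Ef' [pg qg xg yg].
rewrite (ends_crosses_parity Ee) // (ends_crosses_parity Ef) //.
rewrite (ends_crosses_parity Ee') // (ends_crosses_parity Ef') //.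
by case: (_ < p < _); case: (_ < q < _); case: (_ < x < _); case: (_ < y < _).
Qed.

(** Matchings that join [p] to [q] contribute [B q q = 0]; the transposition of [p] and [q] cancels
    the others in pairs. *)
Lemma matching_sum_eq0 U p q : p \in U -> q \in U -> p != q ->
  (forall x, B p x = B q x) -> matching_sum U = 0%R.
Proof.
move=> pU qU pq Bpq; rewrite /matching_sum.
pose has_pq E := [exists e in E, ends e == [set p; q]].
rewrite (bigID has_pq) /= big1 ?add0r; last first.
  move=> E /andP[_ /exists_inP[e eE /eqP Ee]].
  rewrite (bigD1 e) //= (edge_entry Ee) Bpq B_alt mulr0 mul0r mulr0 //.
have involE E : relabel (tperm p q) @: (relabel (tperm p q) @: E) = E.
  rewrite -imset_comp (eq_imset _ (g := id)) ?imset_id // => e.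
  exact: relabel_tpermK.
have splitE E : perfect_matching U E && ~~ has_pq E ->
    exists e f x y (E0 : {set edge n}), [/\ E = e |: (f |: E0), e != f,
    e \notin E0, f \notin E0
    & [/\ ends e = [set p; x], ends f = [set q; y], uniq [:: p; q; x; y]
       & forall g, g \in E0 -> [/\ p \notin ends g, q \notin ends g,
           x \notin ends g & y \notin ends g]]].
  case/andP=> PM NE; have [[e eE Ee]|//] := split_matching pU qU pq PM.
  by case/exists_inP: NE; exists e; rewrite ?Ee.
apply: (sum_involution (s := fun E => relabel (tperm p q) @: E)) => //.
- move=> E /andP[PM NE]; rewrite tperm_perfect_matching //=.
  apply: contra NE => /exists_inP[_ /imsetP[e eE ->] /eqP Ee].
  apply/exists_inP; exists e => //.
  rewrite -(relabel_tpermK p q e) ends_relabel Ee imsetU !imset_set1.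
  by rewrite tpermL tpermR setUC.
- move=> E /splitE[e [f [x [y [E0 [EE ef eE0 fE0 [Ee Ef U4 H0]]]]]]].
  have H0' g : g \in E0 -> p \notin ends g /\ q \notin ends g by case/H0.
  apply/eqP => /setP/(_ (relabel (tperm p q) e)).
  rewrite EE (relabel_split Ee Ef U4 H0') setU11 => /esym.
  have [_ px py qx [qy xy]] := uniq4 U4.
  have xq : x != q by rewrite eq_sym.
  have Ee' := ends_relabel_tperm Ee xq.
  rewrite !inE => /or3P[/eqP E1|/eqP E1|/H0'[_]].
  + have : q \in ends e by rewrite -E1 Ee' set21.
    by rewrite Ee => /set2P[]/eqP; rewrite 1?eq_sym ?(negbTE pq) ?(negbTE xq).
  + have : x \in ends f by rewrite -E1 Ee' set22.
    by rewrite Ef => /set2P[]/eqP; rewrite ?(negbTE xy) ?(negbTE xq).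
  + by rewrite Ee' set21.
- move=> E /splitE[e [f [x [y [E0 [-> ef eE0 fE0 [Ee Ef U4 H0]]]]]]].
  have H0' g : g \in E0 -> p \notin ends g /\ q \notin ends g by case/H0.
  rewrite (relabel_split Ee Ef U4 H0').
  have [_ px py qx [qy xy]] := uniq4 U4.
  have xq : x != q by rewrite eq_sym.
  have yp : y != p by rewrite eq_sym.
  have Ee' := ends_relabel_tperm Ee xq.
  have := ends_relabel_tperm Ef yp; rewrite tpermC => Ef'.
  move: (relabel _ e) (relabel _ f) Ee' Ef' => e' f' Ee' Ef'.
  have qE0 z h : z \in ends h -> (forall g, g \in E0 -> z \notin ends g) -> h \notin E0.
    by move=> zh H; apply/negP => /H; rewrite zh.
  have e'E0 : e' \notin E0 by apply: (qE0 q); [rewrite Ee' set21|move=> g /H0'[]].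
  have f'E0 : f' \notin E0 by apply: (qE0 p f'); [rewrite Ef' set21|move=> g /H0'[]].
  have e'f' : e' != f'.
    apply/eqP => E1; have : q \in ends f' by rewrite -E1 Ee' set21.
    by rewrite Ef' => /set2P[]/eqP; rewrite 1?eq_sym ?(negbTE pq) // eq_sym (negbTE qy).
  have notin (a b : edge n) : a != b -> a \notin E0 -> a \notin b |: E0.
    by move=> ab aE; rewrite !inE negb_or ab.
  rewrite !big_setU1 ?notin //= !cr_setU1 ?notin // /crossing_number.
  rewrite !big_setU1 //=.
  rewrite (edge_entry Ee) (edge_entry Ef) (edge_entry Ee') (edge_entry Ef') !Bpq.
  have collect (a b c : nat) (u v w : R) :
      ((-1) ^+ a * ((-1) ^+ b * u * ((-1) ^+ c * v * w)) =
       (-1) ^+ (a + (b + c)) * (u * v * w))%R.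
    by rewrite !exprD; ring.
  rewrite !collect -mulNr; congr (_ * _)%R; apply: signr_flip.
  have := swap_parity U4 Ee Ef Ee' Ef'.
  have : odd (\sum_(g in E0) (crosses e g + crosses f g)) =
         odd (\sum_(g in E0) (crosses e' g + crosses f' g)).
    rewrite !(big_morph odd oddD (erefl _)); apply: eq_bigr => g /H0.
    exact: third_edge_parity.
  by rewrite !big_split /= !oddD; do 12!case: (odd _) => //=.
Qed.

End Alternating.

Lemma exists_left_kernel (F : fieldType) (r c : nat) (W : 'M[F]_(r, c)) :
  c < r -> exists2 w : 'rV[F]_r, (w != 0)%R & (w *m W = 0)%R.
Proof.
move=> lt_cr; exists (nz_row (kermx W)); last first.
  by apply/sub_kermxP; apply: nz_row_sub.
rewrite nz_row_eq0 -mxrank_eq0 mxrank_ker subn_eq0 -ltnNge.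
exact: leq_ltn_trans (rank_leq_col W) lt_cr.
Qed.

(** * Pfaffians of forms of rank at most 2k *)

Section LowRank.

Variables (n k : nat).
Implicit Types (E : {set edge n}) (U : {set 'I_n}).

Definition symplectic_form (R : comNzRingType) (a b : 'I_k -> 'I_n -> R)
    (i j : 'I_n) : R :=
  (\sum_(l < k) (a l i * b l j - a l j * b l i))%R.

Lemma symplectic_form_anti (R : comNzRingType) (a b : 'I_k -> 'I_n -> R) i j :
  (symplectic_form a b i j = - symplectic_form a b j i)%R.
Proof.
by rewrite /symplectic_form -sumrN; apply: eq_bigr => l _; rewrite opprB.
Qed.

Lemma symplectic_form_alt (R : comNzRingType) (a b : 'I_k -> 'I_n -> R) i :
  (symplectic_form a b i i = 0)%R.
Proof. by rewrite /symplectic_form big1 // => l _; rewrite subrr. Qed.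

(** The Pfaffian is linear in row [p], and [c p] times this row is minus a combination of the other
    rows. [B u] is [A] with the index [p] replaced by [u], so its rows [p] and [u] agree. *)
Lemma matching_sum_dependent (R : comNzRingType) (A : 'I_n -> 'I_n -> R)
    (c : 'I_n -> R) U p :
  (forall i, A i i = 0)%R -> (forall i j, A i j = - A j i)%R ->
  p \in U -> (forall x, \sum_(u in U) c u * A u x = 0)%R ->
  (c p * matching_sum A U = 0)%R.
Proof.
move=> A_alt A_anti pU dep.
pose sub u z := if z == p then u else z.
pose B u i j := A (sub u i) (sub u j).
suff -> : (c p * matching_sum A U =
    - \sum_(u in U | u != p) c u * matching_sum (B u) U)%R.
  rewrite big1 ?oppr0 // => u /andP[uU up].
  rewrite (@matching_sum_eq0 _ _ (B u) _ _ U p u) ?mulr0 // 1?eq_sym //.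
  - by move=> i; apply: A_alt.
  - by move=> i j; apply: A_anti.
  - by move=> x; rewrite /B /sub eqxx (negbTE up).
rewrite /matching_sum big_distrr /=.
under [X in (_ = - X)%R]eq_bigr do rewrite big_distrr /=.
rewrite exchange_big /= -sumrN; apply: eq_bigr => E /perfect_matchingP[_ H2 H3].
have [e eE pe] := H2 p pU; have [x px Ee] := ends_other pe.
have xp : x != p by rewrite eq_sym.
have rest u : (\prod_(g in E | g != e) B u (val g).1 (val g).2 =
               \prod_(g in E | g != e) A (val g).1 (val g).2)%R.
  apply: eq_bigr => g /andP[gE ge]; rewrite /B /sub.
  have : p \notin ends g by apply: contra ge => pg; rewrite (H3 g e p).
  by rewrite in_ends negb_or !(eq_sym p) => /andP[/negbTE-> /negbTE->].
rewrite (bigD1 e) //= (edge_entry A_anti Ee).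
have cp : (c p * A p x = - \sum_(u in U | u != p) c u * A u x)%R.
  by apply/eqP; rewrite -addr_eq0 -(bigD1 p pU (F := fun u => c u * A u x)%R) dep.
set P := (\prod_(g in E | g != e) _)%R.
set s := ((-1) ^+ cr E)%R; set t := ((-1) ^+ (x < p))%R.
have -> : (c p * (s * (t * A p x * P)) = c p * A p x * (s * (t * P)))%R by ring.
rewrite cp mulNr mulr_suml; congr (- _)%R.
apply: eq_bigr => u /andP[uU up].
rewrite (bigD1 e eE) /= rest -/P.
rewrite (@edge_entry _ _ (B u) _ _ _ _ Ee); last by move=> i j; apply: A_anti.
have -> : B u p x = A u x by rewrite /B /sub eqxx (negbTE xp).
rewrite -/t -/s. by ring.
Qed.

(** The rows indexed by [U] depend linearly on vectors with [k + k] entries, so more than [2 * k] of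
    them satisfy a relation; [p] is taken where its coefficient is invertible. *)
Lemma matching_sum_low_rank (F : fieldType) (a b : 'I_k -> 'I_n -> F) U :
  2 * k < #|U| -> matching_sum (symplectic_form a b) U = 0%R.
Proof.
move=> ltU.
pose W : 'M[F]_(#|U|, k + k) := (row_mx (\matrix_(i, l) a l (enum_val i))
                           (\matrix_(i, l) b l (enum_val i)))%R.
have [|w w0 wW] := @exists_left_kernel _ _ _ W; first lia.
have [i0 wi0] : exists i, (w 0 i != 0)%R by apply/rV0Pn.
pose c u := (\sum_(i < #|U| | enum_val i == u) w 0 i)%R.
have cE i : c (enum_val i) = (w 0 i)%R.
  rewrite /c (bigD1 i) ?eqxx //= big1 ?addr0 // => j /andP[/eqP/enum_val_inj->].
  by rewrite eqxx.
have sum_c (h : 'I_n -> F) :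
    (\sum_(u in U) c u * h u = \sum_i w 0 i * h (enum_val i))%R.
  by rewrite (big_enum_val (fun u => c u * h u)%R); apply: eq_bigr => i _; rewrite cE.
move: wW; rewrite mul_mx_row => /eqP; rewrite row_mx_eq0 => /andP[/eqP wa /eqP wb].
have ca l : (\sum_(u in U) c u * a l u = 0)%R.
  rewrite sum_c; have /rowP/(_ l) := wa; rewrite !mxE => E; rewrite -[RHS]E.
  by apply: eq_bigr => i _; rewrite mxE.
have cb l : (\sum_(u in U) c u * b l u = 0)%R.
  rewrite sum_c; have /rowP/(_ l) := wb; rewrite !mxE => E; rewrite -[RHS]E.
  by apply: eq_bigr => i _; rewrite mxE.
suff dep x : (\sum_(u in U) c u * symplectic_form a b u x = 0)%R.
  have /eqP := matching_sum_dependent (symplectic_form_alt a b)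
    (symplectic_form_anti a b) (enum_valP i0) dep.
  by rewrite mulf_eq0 cE (negbTE wi0) => /eqP.
rewrite /symplectic_form; under eq_bigr do rewrite mulr_sumr.
rewrite exchange_big big1 //= => l _.
under eq_bigr do rewrite mulrBr mulrA [X in (_ - X)%R]mulrCA [X in (_ - X)%R]mulrC.
by rewrite sumrB -!mulr_suml ca cb !mul0r subrr.
Qed.

Lemma rmorph_matching_sum (R S : comNzRingType) (h : {rmorphism R -> S})
    (A : 'I_n -> 'I_n -> R) U :
  h (matching_sum A U) = matching_sum (fun i j => h (A i j)) U.
Proof.
rewrite rmorph_sum; apply: eq_bigr => E _.
by rewrite rmorphM rmorph_sign rmorph_prod.
Qed.

Lemma matching_sum_low_rank_idomain (R : idomainType) (a b : 'I_k -> 'I_n -> R) U :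
  2 * k < #|U| -> matching_sum (symplectic_form a b) U = 0%R.
Proof.
move=> ltU; apply/eqP; rewrite -tofrac_eq0 rmorph_matching_sum; apply/eqP.
rewrite -[RHS](@matching_sum_low_rank _ (fun l i => FracField.tofrac (a l i))
  (fun l i => FracField.tofrac (b l i)) U ltU).
apply: eq_bigr => E _; congr (_ * _)%R; apply: eq_bigr => e _.
by rewrite rmorph_sum; apply: eq_bigr => l _; rewrite rmorphB !rmorphM.
Qed.

End LowRank.

(** * Independence of the non-nesting monomials *)

Section ArcFamilies.

Variables (n k : nat).

Section OneFamily.

Variables (T : finType) (c : T -> 'I_k) (s d : T -> 'I_n).

Definition arc_count (l : 'I_k) (x y : 'I_n) : nat :=
  \sum_(t : T) [&& c t == l, s t == x & d t == y].

Definition arc_cdf (l : 'I_k) (x y : nat) : nat :=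
  \sum_(t : T) [&& c t == l, s t < x & d t < y].

Definition end_count (g : T -> 'I_n) (l : 'I_k) (x : 'I_n) : nat :=
  \sum_(t : T) ((c t == l) && (g t == x)).

Definition end_cdf (g : T -> 'I_n) (l : 'I_k) (x : nat) : nat :=
  \sum_(t : T) ((c t == l) && (g t < x)).

Definition arc_energy : nat := \sum_(t : T) (n - s t) * (n - d t).

Lemma end_cdfE g l x : end_cdf g l x = \sum_(i : 'I_n | i < x) end_count g l i.
Proof.
rewrite /end_cdf /end_count exchange_big /=; apply: eq_bigr => t _.
rewrite big_mkcond (bigD1 (g t)) //= big1 ?addn0; last first.
  by move=> i; rewrite eq_sym => /negbTE->; rewrite andbF; case: ifP.
by rewrite eqxx andbT; case: (c t == l); case: (g t < x).
Qed.

Lemma arc_cdf_le l x y : arc_cdf l x y <= minn (end_cdf s l x) (end_cdf d l y).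
Proof.
rewrite leq_min; apply/andP; split; apply: leq_sum => t _;
by case: (c t == l); case: (s t < x); case: (d t < y).
Qed.

(** If some arc of colour [l] starts before [x] and ends at [y] or later, non-nesting makes every
    arc ending before [y] start before [x]. Otherwise every arc starting before [x] ends before
    [y]. *)
Lemma arc_cdf_eq l x y :
  (forall t u, c t = c u -> s t < s u -> d u < d t -> False) ->
  arc_cdf l x y = minn (end_cdf s l x) (end_cdf d l y).
Proof.
move=> non_nested; apply/eqP; rewrite eqn_leq arc_cdf_le geq_min /=.
case: (boolP [exists t, [&& c t == l, s t < x & y <= d t]]) => [/existsP[t]|].
  move=> /and3P[/eqP ct st dt]; apply/orP; right; apply: leq_sum => u _.
  case: eqVneq => //= cu; case: (ltnP (d u) y) => //= du.
  case: (ltnP (s u) x) => // su; case: (non_nested t u) => //; rewrite ?ct //; lia.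
rewrite negb_exists => /forallP H; apply/orP; left; apply: leq_sum => u _.
have := H u; case: eqVneq => //= cu; case: (s u < x) => //=.
by rewrite -ltnNge => ->.
Qed.

(** The arc [t] is counted once for each [x >= s t] and [y >= d t], in its own colour only. *)
Lemma arc_energyE :
  arc_energy = \sum_(p : 'I_k * 'I_n * 'I_n) arc_cdf p.1.1 p.1.2.+1 p.2.+1.
Proof.
rewrite /arc_energy /arc_cdf exchange_big /=; apply: eq_bigr => t _.
rewrite -(pair_bigA _ (fun (q : 'I_k * 'I_n) (y : 'I_n) =>
  nat_of_bool [&& c t == q.1, s t < q.2.+1 & d t < y.+1])) /=.
rewrite -(pair_bigA _ (fun (l : 'I_k) (x : 'I_n) => \sum_(y < n)
  nat_of_bool [&& c t == l, s t < x.+1 & d t < y.+1])) /=.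
rewrite (bigD1 (c t)) //= [X in _ + X]big1 ?addn0; last first.
  move=> l lt; rewrite big1 // => x _; rewrite big1 // => y _.
  by rewrite eq_sym (negbTE lt).
have cnt (z m : nat) : \sum_(x < m) (z < x.+1) = m - z.
  by elim: m => [|m IH]; rewrite ?big_ord0 // big_ord_recr /= IH; lia.
rewrite -!cnt big_distrl /=; apply: eq_bigr => x _; rewrite big_distrr /=.
by apply: eq_bigr => y _; rewrite eqxx /=; case: (s t < _); case: (d t < _).
Qed.

Lemma arc_countE l (x y : 'I_n) :
  arc_count l x y + (arc_cdf l x y.+1 + arc_cdf l x.+1 y) =
  arc_cdf l x.+1 y.+1 + arc_cdf l x y.
Proof.
rewrite /arc_count /arc_cdf -!big_split /=; apply: eq_bigr => t _.
rewrite -(val_eqE (s t)) -(val_eqE (d t)) /= !ltnS.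
by case: (c t == l); case: (ltngtP (s t) x); case: (ltngtP (d t) y).
Qed.

Lemma arc_cdf0x l y : arc_cdf l 0 y = 0.
Proof. by rewrite /arc_cdf big1 // => t _; rewrite ltn0 andbF. Qed.

Lemma arc_cdfx0 l x : arc_cdf l x 0 = 0.
Proof. by rewrite /arc_cdf big1 // => t _; rewrite ltn0 !andbF. Qed.

End OneFamily.

Lemma eq_sum_leq (I : finType) (a b : I -> nat) :
  (forall i, a i <= b i) -> \sum_i b i <= \sum_i a i -> forall i, a i = b i.
Proof.
move=> ab sba i; apply/eqP; rewrite eqn_leq ab /=.
move: sba; rewrite (bigD1 i) //= [X in _ <= X](bigD1 i) //=.
have : \sum_(j | j != i) a j <= \sum_(j | j != i) b j by apply: leq_sum.
lia.
Qed.

(* A non-nested family maximises the two-dimensional distribution function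
   among the families with its numbers of tails and heads, hence is determined
   by these numbers as soon as its energy is not exceeded. *)
Lemma arc_count_rigid (T T' : finType) (c : T -> 'I_k) (s d : T -> 'I_n)
    (c' : T' -> 'I_k) (s' d' : T' -> 'I_n) :
  (forall t u, c t = c u -> s t < s u -> d u < d t -> False) ->
  end_count c s =2 end_count c' s' -> end_count c d =2 end_count c' d' ->
  arc_energy s d <= arc_energy s' d' ->
  forall l x y, arc_count c' s' d' l x y = arc_count c s d l x y.
Proof.
move=> non_nested Es Ed; rewrite (arc_energyE c) (arc_energyE c') => leE l x y.
have le_cdf p q r : arc_cdf c' s' d' p q r <= arc_cdf c s d p q r.
  rewrite (arc_cdf_eq p q r non_nested); apply: leq_trans (arc_cdf_le _ _ _ _ _ _) _.
  rewrite !end_cdfE (eq_bigr _ (fun i _ => Es p i)) (eq_bigr _ (fun i _ => Ed p i)).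
  exact: leqnn.
have E := eq_sum_leq (fun p : 'I_k * 'I_n * 'I_n => le_cdf p.1.1 p.1.2.+1 p.2.+1) leE.
have {}E (a b : nat) : a <= n -> b <= n ->
    arc_cdf c' s' d' l a b = arc_cdf c s d l a b.
  case: a => [|a] an; first by rewrite !arc_cdf0x.
  case: b => [|b] bn; first by rewrite !arc_cdfx0.
  exact: (E (l, Ordinal an, Ordinal bn)).
have := arc_countE c s d l x y; have := arc_countE c' s' d' l x y.
have := ltn_ord x; have := ltn_ord y => yn xn; rewrite !E //; try exact: ltnW.
lia.
Qed.

End ArcFamilies.

(** * Substitution of the generic form of rank 2k *)

Section GenericRank.

Variables (K : fieldType) (n k : nat).
Local Notation N := #|{: edge n}|.
Local Notation label := (bool * 'I_k * 'I_n)%type.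
Local Notation M := #|{: label}|.
Implicit Types (e f : edge n) (m : 'X_{1..N}).

(** The boolean tells the variables a ([false]) from the variables b ([true]). *)
Definition label_var (c : bool) (l : 'I_k) (i : 'I_n) : {mpoly K[M]} :=
  'X_(enum_rank (c, l, i)).

Definition generic_entry (i j : 'I_n) : {mpoly K[M]} :=
  symplectic_form (label_var false) (label_var true) i j.

Definition generic_rank : edge_poly K n -> {mpoly K[M]} :=
  mmap (mpolyC M (R := K))
    (fun i => generic_entry (val (enum_val i)).1 (val (enum_val i)).2).

HB.instance Definition _ := GRing.RMorphism.on generic_rank.

Lemma generic_rank_var e :
  generic_rank (edge_var K e) = generic_entry (val e).1 (val e).2.
Proof. by rewrite /generic_rank mmapX mmap1U enum_rankK. Qed.

Lemma generic_rank_pfaffian (U : {set 'I_n}) : #|U| = 2 * k.+1 ->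
  generic_rank (pfaffian K U) = 0%R.
Proof.
move=> cU; rewrite -[RHS](@matching_sum_low_rank_idomain n k _
  (label_var false) (label_var true) U); last by rewrite cU; lia.
rewrite /pfaffian rmorph_sum; apply: eq_bigr => E _.
rewrite rmorphM rmorph_sign /edge_monomial rmorph_prod; congr (_ * _)%R.
by apply: eq_bigr => e _; apply: generic_rank_var.
Qed.

Lemma generic_rank_ideal (f : edge_poly K n) :
  pfaffian_ideal K k n f -> generic_rank f = 0%R.
Proof.
move=> [r [a [g [Hg ->]]]]; rewrite rmorph_sum big1 // => i _.
have [U [cU ->]] := Hg i; by rewrite rmorphM /= generic_rank_pfaffian ?mulr0.
Qed.

Lemma edge_eqE e f :
  (e == f) = ((val e).1 == (val f).1) && ((val e).2 == (val f).2).
Proof. by rewrite -val_eqE; case: (val e) (val f) => [a b] [c d]. Qed.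

Section Expansion.

Variable m : 'X_{1..N}.

Local Notation copies := {i : 'I_N & 'I_(m i)}.
Implicit Types (t : copies) (h : {ffun copies -> 'I_k * bool}).

Definition copy_edge t : edge n := enum_val (tag t).
(** A term of the expanded product is indexed by [h], which gives each copy of an edge a colour and
    an orientation, reversed if the boolean is [true]. *)
Definition arc_tail h t : 'I_n :=
  if (h t).2 then (val (copy_edge t)).2 else (val (copy_edge t)).1.
Definition arc_head h t : 'I_n :=
  if (h t).2 then (val (copy_edge t)).1 else (val (copy_edge t)).2.
Definition color h t : 'I_k := (h t).1.

Definition arc_mnm h : 'X_{1..M} :=
  (\sum_(t : copies) (U_(enum_rank (false, color h t, arc_tail h t)) +
                      U_(enum_rank (true, color h t, arc_head h t))))%MM.

Lemma generic_rank_monomial :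
  generic_rank 'X_[m] =
  (\sum_(h : {ffun copies -> 'I_k * bool})
     (\prod_(t : copies) (-1) ^+ (h t).2) *: 'X_[arc_mnm h])%R.
Proof.
pose term (i : 'I_N) (c : 'I_k * bool) : {mpoly K[M]} :=
  let e := val (enum_val i) in
  ((-1) ^+ c.2 *: 'X_[U_(enum_rank (false, c.1, if c.2 then e.2 else e.1)) +
           U_(enum_rank (true, c.1, if c.2 then e.1 else e.2))])%R.
have termE i : generic_entry (val (enum_val i)).1 (val (enum_val i)).2 =
    (\sum_c term i c)%R.
  rewrite -(pair_bigA _ (fun l b => term i (l, b))) /=; apply: eq_bigr => l _.
  by rewrite big_bool /term /= expr1 scaleN1r expr0 scale1r !mpolyXD addrC.
rewrite /generic_rank mmapX /mmap1.
rewrite (eq_bigr (fun i => \prod_(j < m i) \sum_c term i c)%R); last first.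
  by move=> i _; rewrite termE prodr_const card_ord.
rewrite (sig_big_dep _ _ (fun i (j : 'I_(m i)) => \sum_c term i c)%R) /=.
rewrite bigA_distr_bigA /=; apply: eq_bigr => h _.
by rewrite /term scaler_prod mprodXE.
Qed.

(** Exponents record only the numbers of tails and heads of each colour at each vertex, which are
    the data of [arc_count_rigid]. *)
Lemma arc_mnmE h b l x : arc_mnm h (enum_rank (b, l, x)) =
  end_count (color h) (if b then arc_head h else arc_tail h) l x.
Proof.
rewrite /arc_mnm mnm_sumE; apply: eq_bigr => t _.
rewrite mnmDE !mnm1E !(inj_eq enum_rank_inj) !xpair_eqE.
by case: b; rewrite /= ?addn0.
Qed.

Lemma mult_copies e : mult m e = \sum_(t : copies) (copy_edge t == e).
Proof.
have -> : \sum_(t : copies) (copy_edge t == e) =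
    \sum_(i < N) \sum_(j < m i) (enum_val i == e).
  by rewrite (sig_big_dep _ _ (fun i (j : 'I_(m i)) => nat_of_bool (enum_val i == e))).
rewrite (bigD1 (enum_rank e)) //= [X in _ + X]big1 ?addn0; last first.
  move=> i ne; rewrite big1 // => j _; case: eqP => // E.
  by rewrite -E enum_valK eqxx in ne.
by rewrite enum_rankK eqxx sum_nat_const card_ord muln1.
Qed.

Lemma mult_arc_count h e :
  mult m e = \sum_(l < k) (arc_count (color h) (arc_tail h) (arc_head h) l (val e).1 (val e).2
    + arc_count (color h) (arc_tail h) (arc_head h) l (val e).2 (val e).1).
Proof.
rewrite mult_copies /arc_count.
under [RHS]eq_bigr do rewrite -big_split /=.
rewrite exchange_big /=; apply: eq_bigr => t _.
rewrite (bigD1 (color h t)) //= big1 ?addn0; last first.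
  by move=> l; rewrite eq_sym => /negbTE->.
rewrite eqxx edge_eqE /arc_tail /arc_head -!val_eqE /=.
have := edge_lt e; have := edge_lt (copy_edge t).
by case: (h t).2 => /=; lia.
Qed.

Definition edge_energy : nat :=
  \sum_(e : edge n) mult m e * ((n - (val e).1) * (n - (val e).2)).

(** The energy is symmetric in tail and head, so it does not depend on the orientations. *)
Lemma arc_energy_copies h : arc_energy (arc_tail h) (arc_head h) = edge_energy.
Proof.
transitivity (\sum_(t : copies) (n - (val (copy_edge t)).1) * (n - (val (copy_edge t)).2)).
  apply: eq_bigr => t _; rewrite /arc_tail /arc_head; case: (h t).2 => //.
  by rewrite mulnC.
rewrite /edge_energy; under [RHS]eq_bigr do rewrite mult_copies big_distrl /=.
rewrite exchange_big /=; apply: eq_bigr => t _.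
rewrite (bigD1 (copy_edge t)) //= big1 ?addn0 ?eqxx ?mul1n //.
by move=> e; rewrite eq_sym => /negbTE->.
Qed.

Lemma mult_copy_gt0 t : 0 < mult m (copy_edge t).
Proof.
by rewrite mult_copies (bigD1 t) //= eqxx.
Qed.

End Expansion.

Definition forward (col : edge n -> 'I_k) m :
    {ffun {i : 'I_N & 'I_(m i)} -> 'I_k * bool} :=
  [ffun t => (col (copy_edge t), false)].

Lemma forward_non_nested col m t u : nest_coloring m col ->
  color (forward col m) t = color (forward col m) u ->
  arc_tail (forward col m) t < arc_tail (forward col m) u ->
  arc_head (forward col m) u < arc_head (forward col m) t -> False.
Proof.
move=> colP; rewrite /color /arc_tail /arc_head !ffunE /= => ct st dt.
have : nests (copy_edge t) (copy_edge u) by rewrite /nests st dt.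
by move/(colP _ _ (mult_copy_gt0 t) (mult_copy_gt0 u)); rewrite ct eqxx.
Qed.

(** By [arc_count_rigid], any term with this monomial has the arc counts of the forward term. These
    determine the edge multiset, so [m' = m], and then all orientations and colours. *)
Lemma coeff_forward col m m' : nest_coloring m col ->
  edge_energy m <= edge_energy m' ->
  ((generic_rank 'X_[m'])@_(arc_mnm (forward col m)) = (m' == m)%:R)%R.
Proof.
move=> colP leE; rewrite generic_rank_monomial raddf_sum /=.
have rigid (h : {ffun {i : 'I_N & 'I_(m' i)} -> 'I_k * bool}) :
    arc_mnm h = arc_mnm (forward col m) -> forall l x y,
    arc_count (color h) (arc_tail h) (arc_head h) l x y =
    arc_count (color (forward col m)) (arc_tail (forward col m))
      (arc_head (forward col m)) l x y.
  move=> E; apply: arc_count_rigid.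
  - by move=> t u; apply: forward_non_nested.
  - move=> l x; have := arc_mnmE h false l x.
    by rewrite E arc_mnmE.
  - move=> l x; have := arc_mnmE h true l x.
    by rewrite E arc_mnmE.
  - by rewrite !arc_energy_copies.
have [E|ne] := eqVneq m' m; last first.
  rewrite big1 // => h _; rewrite mcoeffZ mcoeffX.
  case: eqP => [/rigid R|_]; last by rewrite mulr0.
  case/eqP: ne; apply: mult_inj => e.
  rewrite (mult_arc_count h) (mult_arc_count (forward col m)).
  by apply: eq_bigr => l _; rewrite !R.
subst m'; rewrite (bigD1 (forward col m)) //= [X in (_ + X)%R]big1 ?addr0; last first.
  move=> h ne; rewrite mcoeffZ mcoeffX; case: eqP => [/rigid R|_]; last by rewrite mulr0.
  case/eqP: ne; apply/ffunP => t.
  have : 0 < arc_count (color h) (arc_tail h) (arc_head h) (color h t) (arc_tail h t) (arc_head h t).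
    by rewrite /arc_count (bigD1 t) //= !eqxx.
  rewrite R lt0n sum_nat_eq0 => /forallPn[u].
  rewrite implyTb eqb0 negbK /color /arc_tail /arc_head !ffunE /=.
  move=> /and3P[/eqP cu /eqP su /eqP du].
  have lt_u := edge_lt (copy_edge u).
  (* A reversed copy would have its tail after its head, unlike every forward arc. *)
  move: su du; case ht: (h t) cu => [l [|]] /= cu su du.
    by move: lt_u (edge_lt (copy_edge t)); rewrite /= su du; lia.
  congr (_, _); rewrite -cu; congr col; apply/eqP.
  by rewrite edge_eqE /= su du !eqxx.
rewrite mcoeffZ mcoeffX !eqxx mulr1 big1 // => t _.
by rewrite ffunE.
Qed.

(** A triangularity argument: for [m] of least energy in the support, the coefficient of the forward
    monomial of [m] in the image is [f@_m]. *)
Lemma generic_rank_neq0 (f : edge_poly K n) : f != 0%R ->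
  (forall m, m \in msupp f -> nest_colorable k m) -> generic_rank f != 0%R.
Proof.
move=> f0 colf.
have exm : exists q, has (fun m => edge_energy m == q) (msupp f).
  move: f0; rewrite -msupp_eq0; case E: (msupp f) => [|m s] // _.
  by exists (edge_energy m); rewrite /= eqxx.
case: (ex_minnP exm) => q /hasP[m mf /eqP Em] min_q.
have [col colP] := nest_colorableP _ _ (colf m mf).
apply/eqP => E; move: (mf); rewrite mcoeff_msupp => /eqP; apply.
have := congr1 (mcoeff (arc_mnm (forward col m))) E.
have -> : ((generic_rank f)@_(arc_mnm (forward col m)) = f@_m)%R; last first.
  by rewrite mcoeff0 => ->.
rewrite {1}(mpolyE f) rmorph_sum raddf_sum /=.
rewrite (bigD1_seq m mf (msupp_uniq f)) /= [X in (_ + X)%R]big_seq_cond.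
rewrite {1}/generic_rank mmapZ mcoeffCM coeff_forward // eqxx mulr1.
rewrite big1 ?addr0 // => m' /andP[m'f ne].
rewrite /generic_rank mmapZ mcoeffCM coeff_forward ?(negbTE ne) ?mulr0 //.
by rewrite Em min_q //; apply/hasP; exists m'.
Qed.

End GenericRank.

(** * Crossing monomials are leading *)

Section MatchingSums.

Variable n : nat.
Implicit Types (e f g : edge n) (E C : {set edge n}) (U : {set 'I_n}).

Lemma sum_perfect_matching U E (F : 'I_n -> nat) : perfect_matching U E ->
  \sum_(u in U) F u = \sum_(e in E) (F (val e).1 + F (val e).2).
Proof.
case/and3P=> /eqP <- triv _; rewrite big_trivIset // big_imset /=; last first.
  by move=> e f _ _; apply: ends_inj.
apply: eq_bigr => e _; rewrite /ends big_setU1 ?big_set1 //.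
by rewrite inE -val_eqE neq_ltn edge_lt.
Qed.

Lemma crossing_pair m C e f : is_crossing m C -> e \in C -> f \in C ->
  e != f -> crosses e f.
Proof.
by case/andP=> _ /forall_inP H eC fC; have /forall_inP/(_ f fC)/implyP := H e eC.
Qed.

Lemma crossing_ends m C e f x : is_crossing m C -> e \in C -> f \in C ->
  x \in ends e -> x \in ends f -> e = f.
Proof.
move=> cC eC fC xe xf; apply: contraTeq isT => ef.
have := crossing_pair cC eC fC ef; rewrite crossesE.
move: xe xf; rewrite !in_ends -!val_eqE /=.
by have := edge_lt e; have := edge_lt f; rewrite /=; lia.
Qed.

Definition vertices E : {set 'I_n} := cover ((@ends n) @: E).

Lemma crossing_perfect_matching m C : is_crossing m C ->
  perfect_matching (vertices C) C.
Proof.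
move=> cC; apply/perfect_matchingP; split.
- by move=> e eC; apply: (bigcup_max (ends e)); rewrite ?imset_f.
- by move=> u /bigcupP[_ /imsetP[e eC ->] ue]; exists e.
- by move=> e f u eC fC; apply: crossing_ends cC eC fC.
Qed.

Definition rank_in U (u : 'I_n) : nat := \sum_(x in U) (x < u).

Lemma below_inj U u w : u \in U -> w \in U -> rank_in U u = rank_in U w -> u = w.
Proof.
wlog lt : u w / u < w => [H uU wU E|uU wU].
  case: (ltngtP u w) => [lt|gt|/val_inj//]; first exact: H.
  by apply/esym; apply: H.
rewrite /rank_in => E; suff : rank_in U u < rank_in U w by rewrite /rank_in E ltnn.
rewrite /rank_in (bigD1 u) //= [X in _ < X](bigD1 u) //= ltnn lt ltnS.
by apply: leq_sum => x _; case: (ltnP x u) => // xu; rewrite (ltn_trans xu lt).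
Qed.

(* Every edge of [C] has exactly one end in the interval between the ends of
   [e], the left end included. *)
Lemma crossing_below m U C e : is_crossing m C -> perfect_matching U C -> e \in C ->
  rank_in U (val e).2 = rank_in U (val e).1 + m.
Proof.
move=> cC PM eC; rewrite /rank_in !(sum_perfect_matching _ PM).
have /andP[/eqP <- _] := cC; rewrite -sum1_card -big_split /=.
apply: eq_bigr => f fC; have lt_e := edge_lt e; have lt_f := edge_lt f.
have [<-|ef] := eqVneq e f; first by rewrite /= in lt_e *; lia.
have := crossing_pair cC eC fC ef; rewrite crossesE; rewrite /= in lt_e lt_f *; lia.
Qed.

(** By [crossing_below] every edge joins the vertex of some rank [r] in [U] to the vertex of rank
    [r + m]. *)
Lemma crossing_matching_uniq m U C C' : is_crossing m C -> is_crossing m C' ->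
  perfect_matching U C -> perfect_matching U C' -> C = C'.
Proof.
move=> cC cC' PM PM'; have cardU : #|U| = 2 * m.
  by rewrite (card_perfect_matching PM); have /andP[/eqP-> _] := cC.
have cardC : #|C| = #|C'| by have /andP[/eqP-> _] := cC; have /andP[/eqP-> _] := cC'.
apply/eqP; rewrite eqEcard cardC leqnn andbT; apply/subsetP => e eC.
have [H1 H2 H3] := perfect_matchingP _ _ PM; have [H1' H2' H3'] := perfect_matchingP _ _ PM'.
have e1U : (val e).1 \in U by apply: (subsetP (H1 e eC)); rewrite in_ends eqxx.
have e2U : (val e).2 \in U by apply: (subsetP (H1 e eC)); rewrite in_ends eqxx orbT.
have [f fC' e1f] := H2' _ e1U.
have f1U : (val f).1 \in U by apply: (subsetP (H1' f fC')); rewrite in_ends eqxx.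
have f2U : (val f).2 \in U by apply: (subsetP (H1' f fC')); rewrite in_ends eqxx orbT.
have Be := crossing_below cC PM eC; have Bf := crossing_below cC' PM' fC'.
have below_lt u : u \in U -> rank_in U u < 2 * m.
  move=> uU; rewrite /rank_in -cardU (bigD1 u) //= ltnn add0n (cardsD1 u) uU ltnS.
  rewrite -sum1_card [X in _ <= X](eq_bigl (fun i => (i \in U) && (i != u))).
    by apply: leq_sum => x _; case: (x < u).
  by move=> x; rewrite !inE andbC.
move: e1f; rewrite in_ends => /orP[]/eqP E1.
  suff -> : e = f by [].
  apply: val_inj; rewrite [LHS]surjective_pairing [RHS]surjective_pairing.
  rewrite E1; congr (_, _); apply: (below_inj e2U f2U).
  by rewrite Be Bf E1.
(* If the left end of [e] were the right end of [f], two jumps by [m] would reach a rank of at least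
   [2 * m]. *)
have := below_lt _ e2U; rewrite Be E1 Bf mul2n -addnn -addnA.
by rewrite ltnNge leq_addl.
Qed.

(** [Z] is only an additive monoid, so as to cover real weights and the natural numbers
    [chord_weight]; hence the form without subtraction. *)
Lemma sum_swap (Z : nmodType) (F : edge n -> Z) U E e f p q x y :
  perfect_matching U E -> e \in E -> f \in E -> e != f ->
  ends e = [set p; x] -> ends f = [set q; y] ->
  [/\ ends (relabel (tperm p q) e) = [set q; x],
      ends (relabel (tperm p q) f) = [set p; y],
      perfect_matching U (relabel (tperm p q) @: E)
    & (\sum_(g in relabel (tperm p q) @: E) F g + (F e + F f) =
       \sum_(g in E) F g
         + (F (relabel (tperm p q) e) + F (relabel (tperm p q) f)))%R].
Proof.
move=> PM eE fE ef Ee Ef; have [H1 _ H3] := perfect_matchingP _ _ PM.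
have pe : p \in ends e by rewrite Ee set21.
have qf : q \in ends f by rewrite Ef set21.
have pU : p \in U by apply: subsetP (H1 e eE) _ pe.
have qU : q \in U by apply: subsetP (H1 f fE) _ qf.
have pq : p != q by apply: contra ef => /eqP E1; rewrite (H3 e f p) // E1.
have PM' := tperm_perfect_matching pU qU PM.
case: (split_matching pU qU pq PM) => [[g gE Eg]|].
  case/eqP: ef; rewrite -(H3 g e p) // ?Eg ?set21 //.
  by rewrite (H3 g f q) // Eg set22.
move=> [e1 [f1 [x1 [y1 [E0 [EE ef1 eE0 fE0 [Ee1 Ef1 U4 H0]]]]]]].
have ee1 : e = e1.
  by apply: (H3 e e1 p) => //; [rewrite EE setU11 | rewrite Ee1 set21].
have ff1 : f = f1.
  by apply: (H3 f f1 q) => //; [rewrite EE setU1r ?setU11 | rewrite Ef1 set21].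
subst e1 f1; have [_ px py qx [qy xy]] := uniq4 U4.
have xx1 : x1 = x.
  have : x1 \in ends e by rewrite Ee1 set22.
  by rewrite Ee => /set2P[E1|//]; rewrite E1 eqxx in px.
have yy1 : y1 = y.
  have : y1 \in ends f by rewrite Ef1 set22.
  by rewrite Ef => /set2P[E1|//]; rewrite E1 eqxx in qy.
subst x1 y1; have H0' g : g \in E0 -> p \notin ends g /\ q \notin ends g by case/H0.
have xq : x != q by rewrite eq_sym.
have yp : y != p by rewrite eq_sym.
have Ee' := ends_relabel_tperm Ee xq.
have := ends_relabel_tperm Ef yp; rewrite tpermC => Ef'.
split=> //.
rewrite EE (relabel_split Ee Ef U4 H0').
move: (relabel _ e) (relabel _ f) Ee' Ef' => e' f' Ee' Ef'.
have e'E0 : e' \notin E0 by apply/negP => /H0'[_]; rewrite Ee' set21.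
have f'E0 : f' \notin E0 by apply/negP => /H0'[+ _]; rewrite Ef' set21.
have e'f' : e' != f'.
  apply/eqP => E1; have : q \in ends f' by rewrite -E1 Ee' set21.
  by rewrite Ef' => /set2P[]/eqP; rewrite 1?eq_sym ?(negbTE pq) // eq_sym (negbTE qy).
rewrite !big_setU1 ?in_setU1 ?negb_or ?ef ?e'f' //=.
have shuffle (a b c d s : Z) : (a + (b + s) + (c + d) = c + (d + s) + (a + b))%R.
  by rewrite addrC (addrA a) (addrA c) [RHS]addrAC [LHS]addrA.
exact: shuffle.
Qed.

End MatchingSums.

(** * A strictly fp-positive weight *)

Section CircularWeight.

Variable n : nat.
Implicit Types (e f g : edge n) (E C : {set edge n}) (U : {set 'I_n}).

(* Strictly fp-positive: it breaks the ties left by an fp-positive weight. *)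
Definition chord_weight e : nat :=
  ((val e).2 - (val e).1) * (n - ((val e).2 - (val e).1)).

(** In terms of the four circular gaps [p], [q], [r], [z], of sum [n], the difference is
    [2 * q * z]. *)
Lemma chord_weight_adjacent a b c d : a < b -> b < c -> c < d -> d < n ->
  (b - a) * (n - (b - a)) + (d - c) * (n - (d - c)) <
  (c - a) * (n - (c - a)) + (d - b) * (n - (d - b)).
Proof.
move=> ab bc cd dn.
set p := b - a; set q := c - b; set r := d - c; set z := n - (d - a).
have p0 : 0 < p by rewrite /p; lia.
have q0 : 0 < q by rewrite /q; lia.
have z0 : 0 < z by rewrite /z; lia.
have -> : n - p = q + r + z by rewrite /p /q /r /z; lia.
have -> : n - r = p + q + z by rewrite /p /q /r /z; lia.
have -> : n - (c - a) = r + z by rewrite /p /q /r /z; lia.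
have -> : n - (d - b) = p + z by rewrite /p /q /r /z; lia.
have -> : c - a = p + q by rewrite /p /q; lia.
have -> : d - b = q + r by rewrite /q /r; lia.
have qz : 0 < q * z by rewrite muln_gt0 q0.
by rewrite !mulnDl !mulnDr !(mulnC q) !(mulnC r p); move: qz; rewrite mulnC; lia.
Qed.

(** With the same circular gaps the difference is [2 * p * r]. *)
Lemma chord_weight_nested a b c d : a < b -> b < c -> c < d -> d < n ->
  (d - a) * (n - (d - a)) + (c - b) * (n - (c - b)) <
  (c - a) * (n - (c - a)) + (d - b) * (n - (d - b)).
Proof.
move=> ab bc cd dn.
set p := b - a; set q := c - b; set r := d - c; set z := n - (d - a).
have p0 : 0 < p by rewrite /p; lia.
have r0 : 0 < r by rewrite /r; lia.
have -> : n - q = p + r + z by rewrite /p /q /r /z; lia.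
have -> : n - (c - a) = r + z by rewrite /p /q /r /z; lia.
have -> : n - (d - b) = p + z by rewrite /p /q /r /z; lia.
have -> : c - a = p + q by rewrite /p /q; lia.
have -> : d - b = q + r by rewrite /q /r; lia.
have -> : d - a = p + q + r by rewrite /p /q /r; lia.
have pr : 0 < p * r by rewrite muln_gt0 p0.
by rewrite !mulnDl !mulnDr !(mulnC q) !(mulnC r p); lia.
Qed.

End CircularWeight.

(** * The crossing matching is the strict maximum *)

Section Uncrossing.

Variables (R : realType) (n : nat) (v : weight R n).
Implicit Types (e f g : edge n) (E C : {set edge n}) (U : {set 'I_n}).
Hypothesis fp_v : fp_positive v.

Lemma fp_positive_edges (a b c d : 'I_n) e1 e2 e3 e4 g h : a < b -> b < c -> c < d ->
  val e1 = (a, b) -> val e2 = (c, d) -> val e3 = (a, d) -> val e4 = (b, c) ->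
  val g = (a, c) -> val h = (b, d) ->
  (v e1 + v e2 <= v g + v h)%R /\ (v e3 + v e4 <= v g + v h)%R.
Proof.
move=> ab bc cd E1 E2 E3 E4 Eg Eh; have := fp_v ab bc cd.
have mk (x y : 'I_n) (xy : x < y) e : val e = (x, y) -> mkedge xy = e.
  by move=> Ee; apply: val_inj; rewrite Ee.
rewrite /= (mk _ _ _ _ E1) (mk _ _ _ _ E2) (mk _ _ _ _ E3) (mk _ _ _ _ E4).
rewrite (mk _ _ _ _ Eg) (mk _ _ _ _ Eh).
by rewrite ge_max => /andP[].
Qed.

Definition edges_lt E E' : bool :=
  ((\sum_(e in E) v e < \sum_(e in E') v e)%R
   || ((\sum_(e in E) v e == \sum_(e in E') v e)%R
       && (\sum_(e in E) chord_weight e < \sum_(e in E') chord_weight e))).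

(** Exchanging an end of [e] with an end of [f] makes them cross. The [v]-weight does not drop, by
    fp-positivity, and [chord_weight] grows strictly. *)
Lemma uncrossing_step U E e f : perfect_matching U E -> e \in E -> f \in E ->
  e != f -> ~~ crosses e f -> exists2 E', perfect_matching U E' & edges_lt E E'.
Proof.
wlog lt_ef : e f / (val e).1 < (val f).1.
  move=> H PM eE fE ef Ncr.
  case: (ltngtP (val e).1 (val f).1) => [lt|gt|E1]; first exact: (H e f).
    by apply: (H f e) => //; rewrite 1?eq_sym 1?crossesC.
  case/eqP: ef; have [_ _ H3] := perfect_matchingP _ _ PM.
  by apply: (H3 e f (val e).1) => //; rewrite !in_ends ?eqxx // (val_inj E1) eqxx.
move=> PM eE fE ef Ncr; have [_ _ H3] := perfect_matchingP _ _ PM.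
have disj x : x \in ends e -> x \notin ends f.
  by move=> xe; apply: contra ef => xf; rewrite (H3 e f x).
have : (val e).2 \notin ends f by apply: disj; rewrite in_ends eqxx orbT.
rewrite in_ends negb_or -!val_eqE => /andP[ne1 ne2].
have lt_e := edge_lt e; have lt_f := edge_lt f.
have nf := ltn_ord (val f).2; have ne := ltn_ord (val e).2.
have conclude p q x y : ends e = [set p; x] -> ends f = [set q; y] ->
    (forall e' f', ends e' = [set q; x] -> ends f' = [set p; y] ->
       (v e + v f <= v e' + v f')%R /\
       chord_weight e + chord_weight f < chord_weight e' + chord_weight f') ->
    exists2 E', perfect_matching U E' & edges_lt E E'.
  move=> Ee Ef H.
  have [Ee' Ef' PM' Sv] := sum_swap v PM eE fE ef Ee Ef.
  have [_ _ _ Sw] := sum_swap (@chord_weight n) PM eE fE ef Ee Ef.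
  have [le_v lt_w] := H _ _ Ee' Ef'; exists (relabel (tperm p q) @: E) => //.
  rewrite /edges_lt; have : (\sum_(g in E) v g <= \sum_(g in relabel (tperm p q) @: E) v g)%R.
    by rewrite -(lerD2r (v e + v f)%R) Sv lerD2l.
  rewrite le_eqVlt => /orP[->|-> //]; apply/orP; right => /=.
  rewrite -(ltn_add2r (chord_weight e + chord_weight f)).
  have -> : \sum_(g in relabel (tperm p q) @: E) chord_weight g
      + (chord_weight e + chord_weight f) = _ := Sw.
  by rewrite ltn_add2l.
have pair_ends (g : edge n) (a b : 'I_n) : a < b -> ends g = [set b; a] -> val g = (a, b).
  by move=> ab /ends_ordered[_ ->]; rewrite ltnNge (ltnW ab).
have pair_ends' (g : edge n) (a b : 'I_n) : a < b -> ends g = [set a; b] -> val g = (a, b).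
  by move=> ab /ends_ordered[_ ->]; rewrite ab.
have [lt1|ge1] := ltnP (val e).2 (val f).1.
  (* The edges lie side by side: the right end of [e] is exchanged with the left end of [f]. *)
  apply: (conclude (val e).2 (val f).1 (val e).1 (val f).2) => //.
    by rewrite /ends setUC.
  move=> e' f' Ee' Ef'.
  have ve' := pair_ends e' _ _ (ltn_trans lt_e lt1) Ee'.
  have vf' := pair_ends' f' _ _ (ltn_trans lt1 lt_f) Ef'.
  split; last first.
    rewrite /chord_weight ve' vf' /=; exact: chord_weight_adjacent.
  have [e3 Ee3] : exists e3, val e3 = ((val e).1, (val f).2).
    by exists (mkedge (ltn_trans (ltn_trans lt_e lt1) lt_f)).
  have [e4 Ee4] : exists e4, val e4 = ((val e).2, (val f).1).
    by exists (mkedge lt1).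
  by have [] := fp_positive_edges lt_e lt1 lt_f (surjective_pairing (val e))
    (surjective_pairing (val f)) Ee3 Ee4 ve' vf'.
have fe2 : (val f).2 < (val e).2.
  by move: Ncr ge1; rewrite crossesE; move: ne1 ne2 lt_ef lt_e lt_f; rewrite /=; lia.
(* The edge [f] is nested in [e]: the right ends are exchanged. *)
apply: (conclude (val e).2 (val f).2 (val e).1 (val f).1).
- by rewrite /ends setUC.
- by rewrite /ends setUC.
move=> e' f' Ee' Ef'.
have ve' := pair_ends e' _ _ (ltn_trans lt_ef lt_f) Ee'.
have vf' := pair_ends f' _ _ (ltn_trans lt_f fe2) Ef'.
split; last first.
  rewrite /chord_weight ve' vf' /=; exact: chord_weight_nested.
have [e1 Ee1] : exists e1, val e1 = ((val e).1, (val f).1).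
  by exists (mkedge lt_ef).
have [e2 Ee2] : exists e2, val e2 = ((val f).2, (val e).2).
  by exists (mkedge fe2).
by have [] := fp_positive_edges lt_ef lt_f fe2 Ee1 Ee2
  (surjective_pairing (val e)) (surjective_pairing (val f)) ve' vf'.
Qed.

Lemma edges_lt_irr : irreflexive edges_lt.
Proof. by move=> E; rewrite /edges_lt ltxx ltnn andbF. Qed.

Lemma edges_lt_trans : transitive edges_lt.
Proof.
move=> E2 E1 E3 /orP[lt12|/andP[/eqP eq12 lt12]] /orP[lt23|/andP[/eqP eq23 lt23]].
- by apply/orP; left; apply: lt_trans lt23.
- by apply/orP; left; rewrite -eq23.
- by apply/orP; left; rewrite eq12.
- by apply/orP; right; rewrite eq12 eq23 eqxx (ltn_trans lt12).
Qed.

(** Among [x0] and the elements above it, one with the most predecessors is taken. *)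
Lemma exists_maximal (T : finType) (r : rel T) (P : pred T) x0 :
  irreflexive r -> transitive r -> P x0 ->
  exists x, [/\ P x, x = x0 \/ r x0 x & forall y, P y -> ~~ r x y].
Proof.
move=> r_irr r_trans P0.
pose Q x := P x && ((x == x0) || r x0 x).
have Q0 : Q x0 by rewrite /Q P0 eqxx.
case: (arg_maxnP (fun x => #|[set y | r y x]|) Q0) => x /andP[Px x0x] max_x.
exists x; split=> //; first by case/orP: x0x => [/eqP|]; [left|right].
move=> y Py; apply/negP => rxy.
have Qy : Q y.
  rewrite /Q Py; apply/orP; right; case/orP: x0x => [/eqP <- //|r0x].
  exact: r_trans rxy.
have := max_x y Qy; apply/negP; rewrite -ltnNge; apply: proper_card.
apply/properP; split; last by exists x; rewrite !inE ?rxy ?r_irr.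
by apply/subsetP => z; rewrite !inE => /r_trans; apply.
Qed.

Lemma crossing_above U E m : #|U| = 2 * m -> perfect_matching U E ->
  exists C, [/\ is_crossing m C, perfect_matching U C & C = E \/ edges_lt E C].
Proof.
move=> cU PM; have [C [PC EC maxC]] := exists_maximal edges_lt_irr edges_lt_trans PM.
exists C; split=> //; apply/andP; split.
  by have := card_perfect_matching PC; rewrite cU; lia.
apply/forall_inP => e eC; apply/forall_inP => f fC; apply/implyP => ef.
apply/contraT => Ncr; have [E' PE' lt] := uncrossing_step PC eC fC ef Ncr.
by have := maxC E' PE'; rewrite lt.
Qed.

(** The crossing matching that [crossing_above] finds at or above [E] can only be [C], by
    uniqueness. *)
Lemma crossing_max U C E m : is_crossing m C -> perfect_matching U C ->
  perfect_matching U E -> E != C -> edges_lt E C.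
Proof.
move=> cC PC PE; have cU : #|U| = 2 * m.
  by rewrite (card_perfect_matching PC); have /andP[/eqP -> _] := cC.
have [C' [cC' PC' EC']] := crossing_above cU PE.
have E1 := crossing_matching_uniq cC' cC PC' PC.
by case: EC' => [<-|]; rewrite E1 ?eqxx.
Qed.

End Uncrossing.

(** * Initial ideals *)

Section IdealGen.

Local Open Scope ring_scope.
Variable A : comNzRingType.
Implicit Types (S T : set A) (f g : A).

Lemma ideal_gen_mem S g : S g -> ideal_gen S g.
Proof.
by move=> Sg; exists 1%N, (fun=> 1), (fun=> g); split=> //; rewrite big_ord1 mul1r.
Qed.

Lemma ideal_gen0 S : ideal_gen S 0.
Proof.
exists 0%N, (fun=> 0), (fun=> 0); split; first by case.
by rewrite big_ord0.
Qed.

Lemma ideal_genD S f g : ideal_gen S f -> ideal_gen S g -> ideal_gen S (f + g).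
Proof.
move=> [r [a [s [Ss ->]]]] [r' [a' [s' [Ss' ->]]]].
pose pick (h : 'I_r -> A) (h' : 'I_r' -> A) (i : 'I_(r + r')) :=
  match split i with inl j => h j | inr j => h' j end.
exists (r + r')%N, (pick a a'), (pick s s'); split.
  by move=> i; rewrite /pick; case: (split i).
rewrite big_split_ord /=; congr (_ + _); apply: eq_bigr => i _; rewrite /pick.
  by rewrite (unsplitK (inl _ i)).
by rewrite (unsplitK (inr _ i)).
Qed.

Lemma ideal_genM S f g : ideal_gen S g -> ideal_gen S (f * g).
Proof.
move=> [r [a [s [Ss ->]]]]; exists r, (fun i => f * a i), s; split=> //.
by rewrite mulr_sumr; apply: eq_bigr => i _; rewrite mulrA.
Qed.

Lemma ideal_gen_sum S (I : Type) (r : seq I) (P : pred I) (F : I -> A) :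
  (forall i, P i -> ideal_gen S (F i)) -> ideal_gen S (\sum_(i <- r | P i) F i).
Proof. exact: (big_ind (ideal_gen S) (ideal_gen0 S) (@ideal_genD S)). Qed.

Lemma ideal_gen_sub S T : (forall g, S g -> ideal_gen T g) ->
  forall f, ideal_gen S f -> ideal_gen T f.
Proof.
move=> ST f [r [a [s [Ss ->]]]]; apply: ideal_gen_sum => i _.
exact/ideal_genM/ST.
Qed.

End IdealGen.

(** * Monomial multiples of Pfaffians and their leading monomials *)

Section LeadingTerms.

Local Open Scope ring_scope.
Variables (K : fieldType) (R : realType) (k n : nat).
Local Notation N := #|{: edge n}|.
Implicit Types (m t : 'X_{1..N}) (E C : {set edge n}) (U : {set 'I_n}).
Variable v : weight R n.

Definition edges_mnm E : 'X_{1..N} := [multinom (enum_val i \in E : nat) | i < N].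

Lemma mult_edges_mnm E e : mult (edges_mnm E) e = (e \in E).
Proof. by rewrite /mult mnmE enum_rankK. Qed.

Lemma edges_mnm_inj : injective edges_mnm.
Proof.
move=> E E' eq_m; apply/setP => e; have := mult_edges_mnm E e.
by rewrite eq_m mult_edges_mnm; case: (e \in E); case: (e \in E').
Qed.

Lemma multD m t e : mult (m + t)%MM e = (mult m e + mult t e)%N.
Proof. by rewrite /mult mnmDE. Qed.

Lemma edge_monomialE E : edge_monomial K E = 'X_[edges_mnm E].
Proof.
rewrite /edge_monomial /edge_var mprodXE; congr 'X_[_]; apply: mult_inj => e.
rewrite mult_edges_mnm /mult mnm_sumE.
under eq_bigr do rewrite mnm1E (inj_eq enum_rank_inj).
case: (boolP (e \in E)) => eE.
  by rewrite (bigD1 e) //= eqxx big1 // => f /andP[_ /negbTE->].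
by rewrite big1 // => f fE; case: eqP => // E1; rewrite -E1 fE in eE.
Qed.

Lemma mdeg_edges_mnm E : mdeg (edges_mnm E) = #|E|.
Proof.
rewrite mdeg_mult -sum1_card [RHS]big_mkcond; apply: eq_bigr => e _.
by rewrite mult_edges_mnm; case: (e \in E).
Qed.

Lemma monomial_weightD m t :
  monomial_weight v (m + t)%MM = monomial_weight v m + monomial_weight v t.
Proof.
rewrite /monomial_weight -big_split; apply: eq_bigr => e _.
by rewrite mnmDE mulrnDr.
Qed.

Lemma weight_edges_mnm E : monomial_weight v (edges_mnm E) = \sum_(e in E) v e.
Proof.
rewrite /monomial_weight [RHS]big_mkcond; apply: eq_bigr => e _.
by rewrite -/(mult _ _) mult_edges_mnm; case: (e \in E).
Qed.

Definition chord_mnm_weight m : nat := (\sum_(e : edge n) chord_weight e * mult m e)%N.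

Lemma chord_mnm_weightD m t :
  chord_mnm_weight (m + t)%MM = (chord_mnm_weight m + chord_mnm_weight t)%N.
Proof.
rewrite /chord_mnm_weight -big_split; apply: eq_bigr => e _.
by rewrite multD mulnDr.
Qed.

Lemma chord_weight_edges_mnm E :
  chord_mnm_weight (edges_mnm E) = (\sum_(e in E) chord_weight e)%N.
Proof.
rewrite /chord_mnm_weight [RHS]big_mkcond; apply: eq_bigr => e _.
by rewrite mult_edges_mnm; case: (e \in E); rewrite ?muln1 ?muln0.
Qed.

(** In general not a total order: it need only compare the monomials of a Pfaffian multiple with the
    leading one, and have maximal elements on finite sets. *)
Definition mnm_lt m m' : bool :=
  (monomial_weight v m < monomial_weight v m')
  || ((monomial_weight v m == monomial_weight v m')
      && (chord_mnm_weight m < chord_mnm_weight m')%N).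

Lemma mnm_lt_irr : irreflexive mnm_lt.
Proof. by move=> m; rewrite /mnm_lt ltxx ltnn andbF. Qed.

Lemma mnm_lt_trans : transitive mnm_lt.
Proof.
move=> m2 m1 m3 /orP[lt12|/andP[/eqP eq12 lt12]] /orP[lt23|/andP[/eqP eq23 lt23]].
- by apply/orP; left; apply: lt_trans lt23.
- by apply/orP; left; rewrite -eq23.
- by apply/orP; left; rewrite eq12.
- by apply/orP; right; rewrite eq12 eq23 eqxx (ltn_trans lt12).
Qed.

Lemma mnm_lt_weight m m' : ~~ mnm_lt m m' ->
  monomial_weight v m' <= monomial_weight v m.
Proof. by rewrite /mnm_lt negb_or -leNgt => /andP[]. Qed.

Lemma mnm_lt_edges t E C : mnm_lt (t + edges_mnm E)%MM (t + edges_mnm C)%MM =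
  edges_lt v E C.
Proof.
rewrite /mnm_lt !monomial_weightD !chord_mnm_weightD ltrD2l ltn_add2l.
by rewrite (inj_eq (addrI _)) !weight_edges_mnm !chord_weight_edges_mnm.
Qed.

(* Junk value [set0] if [m] contains no (k+1)-crossing. *)
Definition crossing_of m : {set edge n} :=
  odflt set0 [pick C | is_crossing k.+1 C && [forall e in C, 0 < mult m e]%N].

Definition pfaffian_multiple m : edge_poly K n :=
  'X_[m - edges_mnm (crossing_of m)] * pfaffian K (vertices (crossing_of m)).

Lemma crossing_ofP m : has_crossing k m -> is_crossing k.+1 (crossing_of m) /\
  (m - edges_mnm (crossing_of m) + edges_mnm (crossing_of m))%MM = m.
Proof.
move=> /existsP[C0 HC0]; rewrite /crossing_of.
case: pickP => [C /andP[cC /forall_inP sC] /=|/(_ C0)]; last by rewrite HC0.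
split=> //; apply: submK; apply/mnm_lepP => i; rewrite mnmE.
case: (boolP (enum_val i \in C)) => // /sC.
by rewrite /mult enum_valK.
Qed.

Lemma pfaffianE t U : 'X_[t] * pfaffian K U =
  \sum_(E : {set edge n} | perfect_matching U E)
    (-1) ^+ cr E *: 'X_[t + edges_mnm E].
Proof.
rewrite mulr_sumr; apply: eq_bigr => E _.
rewrite edge_monomialE mpolyXD -signr_odd -[in RHS]signr_odd mulrCA.
by case: (odd _); rewrite ?expr1 ?expr0 ?scale1r ?mul1r ?mulN1r ?scaleN1r.
Qed.

Lemma card_vertices C r : is_crossing r C -> #|vertices C| = (2 * r)%N.
Proof.
move=> cC; rewrite (card_perfect_matching (crossing_perfect_matching cC)).
by have /andP[/eqP->] := cC.
Qed.

Lemma coeff_pfaffian_multiple m m' :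
  (pfaffian_multiple m)@_m' =
  \sum_(E : {set edge n} | perfect_matching (vertices (crossing_of m)) E)
    (-1) ^+ cr E * (m - edges_mnm (crossing_of m) + edges_mnm E == m')%MM%:R.
Proof.
rewrite /pfaffian_multiple pfaffianE raddf_sum /=.
by apply: eq_bigr => E _; rewrite mcoeffZ mcoeffX.
Qed.

Lemma pfaffian_multiple_ideal m : has_crossing k m ->
  pfaffian_ideal K k n (pfaffian_multiple m).
Proof.
move=> /crossing_ofP[cC _]; apply/ideal_genM/ideal_gen_mem.
by exists (vertices (crossing_of m)); rewrite (card_vertices cC).
Qed.

Lemma pfaffian_multiple_lead m : has_crossing k m ->
  (pfaffian_multiple m)@_m = (-1) ^+ cr (crossing_of m).
Proof.
move=> Hm; rewrite coeff_pfaffian_multiple //; have [cC Em] := crossing_ofP Hm.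
rewrite (bigD1 (crossing_of m)) ?(crossing_perfect_matching cC) //= Em eqxx mulr1.
rewrite big1 ?addr0 // => E /andP[_ ne].
rewrite -[X in _ == X]Em eqm_add2l (inj_eq edges_mnm_inj) (negbTE ne).
by rewrite mulr0.
Qed.

Lemma coeff_pfaffian_multiple_neq0 m m' :
  (pfaffian_multiple m)@_m' != 0 ->
  exists2 E, perfect_matching (vertices (crossing_of m)) E &
    m' = (m - edges_mnm (crossing_of m) + edges_mnm E)%MM.
Proof.
rewrite coeff_pfaffian_multiple => ne0.
have [/exists_inP[E PE /eqP <-]|] := boolP [exists (E : {set edge n} |
  perfect_matching (vertices (crossing_of m)) E),
  (m - edges_mnm (crossing_of m) + edges_mnm E)%MM == m']; first by exists E.
rewrite negb_exists_in => /forall_inP H; case/eqP: ne0; apply: big1 => E PE.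
by rewrite (negbTE (H E PE)) mulr0.
Qed.

Hypothesis fp_v : fp_positive v.

Lemma pfaffian_multiple_lt m m' : has_crossing k m ->
  (pfaffian_multiple m)@_m' != 0 -> m' != m -> mnm_lt m' m.
Proof.
move=> Hm /coeff_pfaffian_multiple_neq0[E PE ->] ne.
have [cC Em] := crossing_ofP Hm; rewrite -[X in mnm_lt _ X]Em mnm_lt_edges.
apply: (crossing_max fp_v cC (crossing_perfect_matching cC) PE).
by apply: contra ne => /eqP->; rewrite Em.
Qed.

Lemma mdeg_pfaffian_multiple m m' : has_crossing k m ->
  (pfaffian_multiple m)@_m' != 0 -> mdeg m' = mdeg m.
Proof.
move=> Hm /coeff_pfaffian_multiple_neq0[E PE ->].
have [cC Em] := crossing_ofP Hm; rewrite -[X in _ = mdeg X]Em !mdegD !mdeg_edges_mnm.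
have := card_perfect_matching PE.
rewrite (card_perfect_matching (crossing_perfect_matching cC)); lia.
Qed.

End LeadingTerms.

(** * Initial forms of combinations of Pfaffian multiples *)

Section InitialForms.

Local Open Scope ring_scope.
Variables (K : fieldType) (R : realType) (k n : nat) (v : weight R n).
Local Notation N := #|{: edge n}|.
Implicit Types (m t : 'X_{1..N}) (E C : {set edge n}) (U : {set 'I_n}).

Lemma coeff_initial_form (f : edge_poly K n) W m0 :
  (forall m, f@_m != 0 -> monomial_weight v m <= W) ->
  f@_m0 != 0 -> monomial_weight v m0 = W ->
  forall m, (initial_form v f)@_m = if monomial_weight v m == W then f@_m else 0.
Proof.
move=> leW f0 W0 m; rewrite /initial_form raddf_sum /=.
have maxE m' : m' \in msupp f ->
    all (fun m2 => monomial_weight v m2 <= monomial_weight v m') (msupp f)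
    = (monomial_weight v m' == W).
  move=> m'f; apply/allP/eqP => [H|-> m2]; last first.
    by rewrite mcoeff_msupp; apply: leW.
  apply/le_anti; rewrite leW -?mcoeff_msupp //= -W0; apply: H.
  by rewrite mcoeff_msupp.
rewrite big_mkcond /=; have [mf|mf] := boolP (m \in msupp f); last first.
  rewrite (memN_msupp_eq0 mf) if_same big_seq big1 // => m' m'f.
  case: ifP => // _; rewrite mcoeffZ mcoeffX; case: eqP => [E|]; last by rewrite mulr0.
  by rewrite -E m'f in mf.
rewrite (bigD1_seq m mf (msupp_uniq f)) /= maxE // mcoeffZ mcoeffX eqxx mulr1.
rewrite big1 ?addr0 // => m' ne; case: ifP => // _.
by rewrite mcoeffZ mcoeffX (negbTE ne) mulr0.
Qed.

Lemma initial_form0 : initial_form v (0 : edge_poly K n) = 0.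
Proof.
by rewrite /initial_form; have -> : msupp (0 : edge_poly K n) = [::] := msupp0 _ _;
  rewrite big_nil.
Qed.

Definition edges_weight E : R := \sum_(e in E) v e.

Definition pfaffian_initial C : edge_poly K n :=
  \sum_(E : {set edge n} | perfect_matching (vertices C) E
      && (edges_weight E == edges_weight C))
    (-1) ^+ cr E *: 'X_[edges_mnm E].

Hypothesis fp_v : fp_positive v.

Lemma edges_weight_max r C E : is_crossing r C ->
  perfect_matching (vertices C) E -> edges_weight E <= edges_weight C.
Proof.
move=> cC PE; have [->|ne] := eqVneq E C; first exact: lexx.
have := crossing_max fp_v cC (crossing_perfect_matching cC) PE ne.
by move=> /orP[/ltW|/andP[/eqP EC _]] //; rewrite /edges_weight EC.
Qed.

Lemma initial_form_pfaffian r C : is_crossing r C ->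
  initial_form v (pfaffian K (vertices C)) = pfaffian_initial C.
Proof.
move=> cC; have pfE : pfaffian K (vertices C) =
    \sum_(E : {set edge n} | perfect_matching (vertices C) E)
      (-1) ^+ cr E *: 'X_[edges_mnm E].
  rewrite -[LHS]mul1r -mpolyX0 pfaffianE; apply: eq_bigr => E _.
  by rewrite add0m.
have coeffE m : (pfaffian K (vertices C))@_m =
    \sum_(E : {set edge n} | perfect_matching (vertices C) E)
      (-1) ^+ cr E * (edges_mnm E == m)%:R.
  by rewrite pfE raddf_sum /=; apply: eq_bigr => E _; rewrite mcoeffZ mcoeffX.
have PC := crossing_perfect_matching cC.
apply/mpolyP => m.
rewrite (@coeff_initial_form _ (edges_weight C) (edges_mnm C)).
- rewrite coeffE /pfaffian_initial raddf_sum /= [RHS]big_mkcondr /=.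
  have -> : (if monomial_weight v m == edges_weight C then
      \sum_(E : {set edge n} | perfect_matching (vertices C) E)
      (-1) ^+ cr E * (edges_mnm E == m)%:R else 0) =
    \sum_(E : {set edge n} | perfect_matching (vertices C) E)
      (if monomial_weight v m == edges_weight C then
        (-1) ^+ cr E * (edges_mnm E == m)%:R else 0) :> K.
    by case: ifP => // _; rewrite big1.
  apply: eq_bigr => E _; rewrite mcoeffZ mcoeffX.
  case: (eqVneq (edges_mnm E) m) => [<-|]; last by rewrite mulr0 !if_same.
  by rewrite weight_edges_mnm.
- move=> m'; rewrite coeffE => ne0.
  have [/exists_inP[E PE /eqP <-]|] := boolP [exists (E : {set edge n} |
      perfect_matching (vertices C) E), edges_mnm E == m'].
    by rewrite weight_edges_mnm; apply: edges_weight_max cC PE.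
  rewrite negb_exists_in => /forall_inP H; case/eqP: ne0; apply: big1 => E PE.
  by rewrite (negbTE (H E PE)) mulr0.
- rewrite coeffE (bigD1 C) //= eqxx mulr1 big1 ?addr0 ?signr_eq0 //.
  by move=> E /andP[_ ne]; rewrite (inj_eq (@edges_mnm_inj n)) (negbTE ne) mulr0.
- exact: weight_edges_mnm.
Qed.

Section Combination.

Variables (D : nat) (a : 'X_{1..N < D} -> K).
Hypothesis a_crossing : forall b, a b != 0 -> has_crossing k b.

Definition combination : edge_poly K n := \sum_b a b *: pfaffian_multiple K k b.

(** Take [u] maximal for [mnm_lt] among the indices with nonzero coefficient. Its monomial occurs in
    no other multiple involved, as it would lie strictly below the index of that multiple; so it
    cannot cancel. *)
Lemma combination_lead b0 : a b0 != 0 ->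
  exists u, [/\ a u != 0, combination@_u != 0 &
    forall b, a b != 0 -> monomial_weight v b <= monomial_weight v u].
Proof.
move=> ab0; pose r : rel 'X_{1..N < D} := fun b c => mnm_lt v b c.
have [||u [au _ max_u]] := @exists_maximal _ r (fun b => a b != 0) b0 _ _ ab0.
- by move=> b; apply: mnm_lt_irr.
- by move=> b c d; apply: mnm_lt_trans.
exists u; split=> // [|b ab]; last exact/mnm_lt_weight/max_u.
rewrite /combination raddf_sum (bigD1 u) //= mcoeffZ pfaffian_multiple_lead ?a_crossing //.
rewrite big1 ?addr0 ?mulf_neq0 ?signr_eq0 // => b bu; rewrite mcoeffZ.
have [->|ab] := eqVneq (a b) 0; first by rewrite mul0r.
have [->|c0] := eqVneq ((pfaffian_multiple K k b)@_u) 0; first by rewrite mulr0.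
have := pfaffian_multiple_lt fp_v (a_crossing ab) c0; rewrite bmeqP eq_sym in bu.
by move=> /(_ bu) lt_ub; have /negP[] := max_u b ab.
Qed.

(** The top weight [W] of the indices is attained by an uncancelled monomial. The initial form is
    therefore the combination of the initial forms of the multiples whose index has weight [W]. *)
Lemma initial_combination :
  ideal_gen (initial_form v @` pfaffians K n k.+1)%classic (initial_form v combination).
Proof.
have [all0|[b0 ab0]] : (forall b, a b = 0) \/ (exists b, a b != 0).
- case: (boolP [exists b, a b != 0]) => [/existsP|]; first by right.
  by rewrite negb_exists => /forallP H; left => b; apply/eqP; rewrite -[_ == _]negbK H.
- rewrite /combination big1 => [|b _]; last by rewrite all0 scale0r.
  by rewrite initial_form0; apply: ideal_gen0.
have [u [au cu max_u]] := combination_lead ab0; set W := monomial_weight v u.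
have max_coeff b m : a b != 0 -> (pfaffian_multiple K k b)@_m != 0 ->
    monomial_weight v m <= W.
  move=> ab c0; apply: le_trans (max_u b ab).
  have [->//|ne] := eqVneq m b.
  have := pfaffian_multiple_lt fp_v (a_crossing ab) c0 ne.
  by move=> /orP[/ltW|/andP[/eqP-> _]].
have max_comb m : combination@_m != 0 -> monomial_weight v m <= W.
  move=> c0; have [/existsP[b /andP[ab cb]]|] :=
    boolP [exists b, (a b != 0) && ((pfaffian_multiple K k b)@_m != 0)].
    exact: max_coeff ab cb.
  rewrite negb_exists => /forallP H; case/eqP: c0; rewrite /combination raddf_sum big1 //.
  move=> b _; rewrite /= mcoeffZ; have := H b; rewrite negb_and !negbK.
  by move=> /orP[]/eqP->; rewrite ?mul0r ?mulr0.
suff -> : initial_form v combination =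
    \sum_(b | (a b != 0) && (monomial_weight v b == W))
      a b *: 'X_[b - edges_mnm (crossing_of k b)]
        * pfaffian_initial (crossing_of k b).
  apply: ideal_gen_sum => b /andP[ab _]; apply/ideal_genM/ideal_gen_mem.
  have [cC _] := crossing_ofP (a_crossing ab).
  rewrite -(initial_form_pfaffian cC).
  exists (pfaffian K (vertices (crossing_of k b))) => //.
  by exists (vertices (crossing_of k b)); rewrite (card_vertices cC).
apply/mpolyP => m; rewrite (coeff_initial_form max_comb cu erefl).
rewrite /combination !raddf_sum /= [RHS]big_mkcond /=.
have -> : (if monomial_weight v m == W then
    \sum_b (a b *: pfaffian_multiple K k b)@_m else 0) =
  \sum_b (if monomial_weight v m == W then (a b *: pfaffian_multiple K k b)@_m else 0).
  by case: ifP => // _; rewrite big1.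
apply: eq_bigr => b _; rewrite mcoeffZ.
have [->|ab] /= := eqVneq (a b) 0; first by rewrite mul0r if_same.
have Hb := a_crossing ab; have [cC Eb] := crossing_ofP Hb.
set C := crossing_of k b in cC Eb *; set t := (b - edges_mnm C)%MM in Eb *.
rewrite coeff_pfaffian_multiple // -/C -/t.
have -> : (a b *: 'X_[t] * pfaffian_initial C)@_m =
    a b * \sum_(E : {set edge n} | perfect_matching (vertices C) E)
      (if edges_weight E == edges_weight C
       then (-1) ^+ cr E * (t + edges_mnm E == m)%MM%:R else 0).
  rewrite -scalerAl mcoeffZ /pfaffian_initial mulr_sumr raddf_sum /= big_mkcondr.
  congr (_ * _); apply: eq_bigr => E _; case: ifP => // _.
  by rewrite -scalerAr -mpolyXD mcoeffZ mcoeffX.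
have sum_if (c : bool) (F : {set edge n} -> K) :
    (if c then a b * \sum_(E | perfect_matching (vertices C) E) F E else 0) =
    a b * \sum_(E | perfect_matching (vertices C) E) (if c then F E else 0).
  by case: c => //; rewrite big1_eq mulr0.
rewrite !sum_if; congr (_ * _); apply: eq_bigr => E PE.
have [<-|] := eqVneq (t + edges_mnm E)%MM m; last by rewrite mulr0 !if_same.
have lebW : monomial_weight v b <= W by apply: max_u.
have leEC := edges_weight_max cC PE.
rewrite monomial_weightD weight_edges_mnm -/(edges_weight E).
have wb : monomial_weight v b = monomial_weight v t + edges_weight C.
  by rewrite -{1}Eb monomial_weightD weight_edges_mnm.
(* A monomial has weight [W] only if both bounds are equalities: [b] has weight [W], and [E] has the
   weight of [C]. *)
rewrite wb in lebW *.
have [->|ne] := eqVneq (edges_weight E) (edges_weight C); first by [].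
rewrite if_same; case: eqP => // EW; case/eqP: ne; apply/le_anti.
by rewrite leEC -(lerD2l (monomial_weight v t)) EW.
Qed.

End Combination.

End InitialForms.

(** * Pfaffian multiples span the ideal *)

Section Spanning.

Local Open Scope ring_scope.
Variables (K : fieldType) (R : realType) (k n : nat) (v : weight R n).
Hypotheses (k_gt0 : (0 < k)%N) (fp_v : fp_positive v).
Local Notation N := #|{: edge n}|.

(* Otherwise [f] and the multiples of Pfaffians, of degree < D, would be more
   numerous than the monomials that are not nest-colourable, and some linear
   combination of them would be a nonzero element of the ideal supported on
   nest-colourable monomials. *)
Lemma pfaffian_ideal_combination (f : edge_poly K n) : pfaffian_ideal K k n f ->
  exists D (a : 'X_{1..N < D} -> K),
    (forall b, a b != 0 -> has_crossing k b) /\ f = combination k a.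
Proof.
move=> If; pose D := msize f; exists D.
pose A := [set b : 'X_{1..N < D} | has_crossing k b].
pose B := [set b : 'X_{1..N < D} | ~~ nest_colorable k b].
pose g (j : 'I_#|A|) : edge_poly K n := pfaffian_multiple K k (enum_val j).
have Aj (j : 'I_#|A|) : has_crossing k (enum_val j).
  by have := enum_valP j; rewrite inE.
pose p (i : 'I_#|A|.+1) := if unlift ord0 i is Some j then g j else f.
(* Row 0 is [f], the other rows are the Pfaffian multiples. A left kernel vector cancels all
   coefficients at monomials that are not nest-colourable. *)
pose W : 'M[K]_(#|A|.+1, #|B|) := \matrix_(i < #|A|.+1, j < #|B|) (p i)@_(enum_val j).
have [|w w0 wW] := @exists_left_kernel _ _ _ W.
  by rewrite ltnS; apply: card_crossing_ge.
pose F := \sum_i w 0 i *: p i.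
have p_ideal i : pfaffian_ideal K k n (p i).
  by rewrite /p; case: unliftP => [j _|_] //; apply/pfaffian_multiple_ideal/Aj.
have F_ideal : pfaffian_ideal K k n F.
  apply: ideal_gen_sum => i _; rewrite -mul_mpolyC; exact/ideal_genM/p_ideal.
have p_deg i m : (p i)@_m != 0 -> (mdeg m < D)%N.
  rewrite /p; case: unliftP => [j _|_].
    by move=> /(mdeg_pfaffian_multiple (Aj j))->; apply: bmdeg.
  by rewrite -mcoeff_msupp; apply: msize_mdeg_lt.
have F_deg m : F@_m != 0 -> (mdeg m < D)%N.
  move=> F0; have [/existsP[i]|] := boolP [exists i, (p i)@_m != 0]; first exact: p_deg.
  rewrite negb_exists => /forallP H; case/eqP: F0; rewrite /F raddf_sum big1 // => i _.
  by rewrite /= mcoeffZ (eqP (negbNE (H i))) mulr0.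
have F_col m : m \in msupp F -> nest_colorable k m.
  rewrite mcoeff_msupp => F0; apply: contraT => Nc.
  pose b := BMultinom (F_deg m F0).
  have bB : b \in B by rewrite inE.
  have := F0; suff -> : F@_m = 0 by rewrite eqxx.
  have /rowP/(_ (enum_rank_in bB b)) := wW.
  rewrite !mxE => E; rewrite -[RHS]E /F raddf_sum; apply: eq_bigr => i _.
  by rewrite /= mcoeffZ mxE enum_rankK_in.
have F0 : F = 0.
  apply/eqP; apply: contraT => /generic_rank_neq0/(_ F_col).
  by rewrite generic_rank_ideal // eqxx.
pose a (b : 'X_{1..N < D}) := \sum_(j < #|A| | enum_val j == b) w 0 (lift ord0 j).
have aE j : a (enum_val j) = w 0 (lift ord0 j).
  rewrite /a (bigD1 j) //= big1 ?addr0 // => i /andP[/eqP/enum_val_inj->].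
  by rewrite eqxx.
have a_crossing b : a b != 0 -> has_crossing k b.
  move=> ab; apply: contraT => Nb; case/eqP: ab; rewrite /a big1 // => j /eqP E.
  by rewrite -E Aj in Nb.
have FE : F = w 0 ord0 *: f + combination k a.
  rewrite /F big_ord_recl {1}/p unlift_none; congr (_ + _).
  rewrite /combination (partition_big (fun j : 'I_#|A| => enum_val j) predT) //=.
  apply: eq_bigr => b _; rewrite /a scaler_suml; apply: eq_bigr => j /eqP <-.
  by rewrite /p liftK.
(* If [f] had coefficient zero, the relation would be a nontrivial one among the Pfaffian multiples,
   against [combination_lead]. *)
have [w00|w00] := eqVneq (w 0 ord0) 0.
  have [i wi] := rV0Pn w w0.
  have [b0 ab0] : exists b, a b != 0.
    move: wi; case: (unliftP ord0 i) => [j ->|->]; last by rewrite w00 eqxx.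
    by rewrite -aE; exists (enum_val j).
  have [u [_ cu _]] := combination_lead fp_v a_crossing ab0.
  by case/eqP: cu; move: F0; rewrite FE w00 scale0r add0r => ->; rewrite mcoeff0.
exists (fun b => - (w 0 ord0)^-1 * a b); split.
  by move=> b; rewrite mulf_eq0 negb_or => /andP[_]; apply: a_crossing.
have -> : combination k (fun b => - (w 0 ord0)^-1 * a b) =
    - (w 0 ord0)^-1 *: combination k a.
  by rewrite /combination scaler_sumr; apply: eq_bigr => b _; rewrite scalerA.
have -> : combination k a = - (w 0 ord0 *: f).
  by apply/eqP; rewrite -addr_eq0 addrC -FE F0.
by rewrite scalerN scaleNr opprK scalerA mulVf // scale1r.
Qed.

Lemma initial_ideal_pfaffians :
  ideal_gen (initial_form v @` pfaffians K n k.+1)%classic =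
  initial_ideal v (pfaffian_ideal K k n).
Proof.
apply/seteqP; split=> f; apply: ideal_gen_sub => _ [g Hg <-].
  apply: ideal_gen_mem; exists g => //; exact: ideal_gen_mem.
have [D [a [a_crossing ->]]] := pfaffian_ideal_combination Hg.
by have := initial_combination fp_v a_crossing.
Qed.

End Spanning.

(** * Generic weights *)

Section Generic.

Local Open Scope ring_scope.
Variables (R : realType) (n : nat).
Implicit Types (v : weight R n) (E C : {set edge n}).

Definition edges_difference E C : weight R n :=
  [ffun e => (e \in E)%:R - (e \in C)%:R].

(** Off these finitely many hyperplanes distinct edge sets have distinct weights, so no two
    matchings tie. *)
Definition separating_hyperplanes : seq (weight R n) :=
  [seq edges_difference p.1 p.2 |
     p <- enum {: {set edge n} * {set edge n}} & p.1 != p.2].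

Lemma separating_hyperplanes_neq0 : 0 \notin separating_hyperplanes.
Proof.
apply/mapP => -[[E C]]; rewrite mem_filter /= => /andP[EC _] E0.
case/eqP: EC; apply/setP => e; have /ffunP/(_ e) := E0; rewrite !ffunE => /esym/eqP.
by rewrite subr_eq0 eqr_nat; case: (e \in E); case: (e \in C).
Qed.

Lemma separated_weights v E C :
  (forall h, h \in separating_hyperplanes -> \sum_(e : edge n) h e * v e != 0) ->
  edges_weight v E = edges_weight v C -> E = C.
Proof.
move=> Hv EC; apply/eqP; apply: contraT => ne.
have /Hv : edges_difference E C \in separating_hyperplanes.
  by apply/mapP; exists (E, C); rewrite // mem_filter ne mem_enum.
case/eqP; under eq_bigr do rewrite ffunE mulrBl.
rewrite sumrB; apply/eqP; rewrite subr_eq0; apply/eqP.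
have sumE (S : {set edge n}) : \sum_(e : edge n) (e \in S)%:R * v e = edges_weight v S.
  rewrite /edges_weight [RHS]big_mkcond; apply: eq_bigr => e _.
  by case: (e \in S); rewrite ?mul1r ?mul0r.
by rewrite !sumE.
Qed.

End Generic.

(** With ties excluded, the initial form of a Pfaffian is its crossing monomial up to sign, and
    signs are units. *)
Lemma initial_ideal_crossings (K : fieldType) (R : realType) (k n : nat)
    (v : weight R n) : fp_positive v ->
  (forall h, h \in separating_hyperplanes R n ->
     (\sum_(e : edge n) h e * v e != 0)%R) ->
  ideal_gen (initial_form v @` pfaffians K n k.+1)%classic =
  ideal_gen (crossing_monomials K n k.+1).
Proof.
move=> fp_v sep.
have inE C : is_crossing k.+1 C -> (initial_form v (pfaffian K (vertices C)) =
    (-1) ^+ cr C *: edge_monomial K C)%R.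
  move=> cC; rewrite (initial_form_pfaffian _ fp_v cC) /pfaffian_initial edge_monomialE.
  rewrite (bigD1 C) /= ?crossing_perfect_matching ?eqxx //; last first.
    by rewrite (crossing_perfect_matching cC).
  rewrite big1 ?addr0 // => E /andP[/andP[_ /eqP EC]].
  by rewrite (separated_weights sep EC) eqxx.
apply/seteqP; split=> f; apply: ideal_gen_sub => g.
  move=> [_ [U [cU ->]] <-].
  (* Without a perfect matching the Pfaffian is an empty sum, with zero initial form; otherwise
     [crossing_above] turns a matching of [U] into a crossing one. *)
  have [/existsP[E PE]|noPM] := boolP [exists E, perfect_matching U E]; last first.
    rewrite /pfaffian big_pred0 ?initial_form0; first exact: ideal_gen0.
    by move=> E; apply/negbTE; move: noPM; rewrite negb_exists => /forallP.
  have [C [cC PC _]] := crossing_above fp_v cU PE.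
  have -> : U = vertices C by have /and3P[/eqP] := PC.
  rewrite inE // -mul_mpolyC; apply/ideal_genM/ideal_gen_mem; by exists C.
move=> [C [cC ->]].
have -> : (edge_monomial K C =
    ((-1) ^+ cr C)%:MP * initial_form v (pfaffian K (vertices C)))%R.
  by rewrite inE // mul_mpolyC scalerA -expr2 sqrr_sign scale1r.
apply/ideal_genM/ideal_gen_mem; exists (pfaffian K (vertices C)) => //.
by exists (vertices C); rewrite (card_vertices cC).
Qed.

Theorem theorem2p8 (K : fieldType) (R : realType) (k n : nat)
    (hk : 1 <= k) (hn : 2 * k + 2 <= n) :
  (forall v : weight R n, fp_positive v ->
     groebner_basis v (pfaffians K n k.+1) (pfaffian_ideal K k n)) /\
  generically (fun v : weight R n => fp_positive v ->
     initial_ideal v (pfaffian_ideal K k n) =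
       ideal_gen (crossing_monomials K n k.+1)).
Proof.
split=> [v fp_v|].
  split; last exact: initial_ideal_pfaffians.
  by move=> f; apply: ideal_gen_mem.
exists (separating_hyperplanes R n); first exact: separating_hyperplanes_neq0.
move=> v sep fp_v; rewrite -initial_ideal_pfaffians //.
exact: initial_ideal_crossings.
Qed.
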